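(* Let $\mathcal L$ be a lattice on $\mathbb X$, let $b$ be a locally integrable function, let $p\in(1,\infty)$, and let $T$ be a strongly $(p,\varepsilon,K)$ mixing martingale transform whose blocks $T_I$ are uniformly bounded in $L^p$, i.e. $\sup_{I\in\mathcal L}\|T_I\|_{L^p\to L^p}<\infty$. If the commutator $[M_b,T]$ is bounded in $L^p$, then the formal sum $$\widetilde b_0:=\sum_{I\in\mathcal L\setminus\mathfrak A^{0,\mathrm{fin}}_{-\infty}}\Delta_I b$$ belongs to $\mathcal{BMO}=\mathcal{BMO}_2$. Moreover, for $p=2$ it is sufficient to assume that $T$ is a weakly $(2,\varepsilon,K)$ mixing martingale transform (with uniformly bounded blocks). Finally, the norm $\|\widetilde b_0\|_{\mathcal{BMO}}$ can be estimated by a constant depending only on $p$, $\|[M_b,T]\|_{L^p\to L^p}$, $\sup_{I\in\mathcal L}\|T_I\|$, $\varepsilon$ and $K$.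
   Context: Setting. $\mathbb X$ is $\mathbb R$ or a (finite or infinite) subinterval of $\mathbb R$; $|\cdot|$ is Lebesgue measure. A lattice $\mathcal L$ on $\mathbb X$ is a collection of non-trivial bounded intervals (of the form $[a,b)$) in $\mathbb X$ that is a union of generations $\mathcal L_k$, $k\in\mathbb Z$, where each $\mathcal L_k$ is a collection of disjoint intervals covering $\mathbb X$, and each $I\in\mathcal L_k$ is a finite disjoint union of intervals $J\in\mathcal L_{k+1}$ (possibly just one, $J=I$). The rank $\mathrm{rk}(I)$ is the largest $k$ with $I\in\mathcal L_k$; if $\mathrm{rk}(I)=k$, the children of $I$ are the $J\in\mathcal L_{k+1}$ with $J\subset I$ (hence $J\subsetneq I$), and $I$ is called the parent of each of them. (If $I\in\mathcal L_k$ for all large $k$, then $I$ has no children and $\Delta_I:=0$.) Put $\langle f\rangle_I=|I|^{-1}\int_I f\,dx$, $\mathbb E_I f=\langle f\rangle_I\mathbf 1_I$, $\Delta_I f=\sum_{J\in\mathrm{child}(I)}\mathbb E_J f-\mathbb E_I f$, and $D_I=\Delta_I L^2$ (functions supported on $I$, constant on each child of $I$, with integral $0$). $\mathfrak A^{0}_{-\infty}$ is the collection of all intervals $\bigcup_{k\in\mathbb Z}I_k$ with $I_k\in\mathcal L_k$, $I_k\subset I_{k-1}$, and $\mathfrak A^{0,\mathrm{fin}}_{-\infty}=\{I\in\mathfrak A^0_{-\infty}:|I|<\infty\}$. All functions are assumed Borel and constant on every interval of the form $\bigcap_k I_k$, $I_k\in\mathcal L_k$, $I_k\subset I_{k-1}$.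 Locally integrable means integrable on every $I\in\mathcal L$. Martingale transforms and commutators. Call $f$ a finite sum if $f=\sum_{I\in\mathcal L}\Delta_I f+\sum_{I\in\mathfrak A^{0,\mathrm{fin}}_{-\infty}}\mathbb E_I f$ with finitely many non-zero terms. A martingale transform is a linear operator $Tf=\sum_{I\in\mathcal L}T_I(\Delta_I f)$ with linear blocks $T_I:D_I\to D_I$ (so $T\mathbb E_I f=0$ for $I\in\mathfrak A^{0,\mathrm{fin}}_{-\infty}$), defined on finite sums; no boundedness is assumed. Its adjoint $T^*$ with respect to $\langle f,g\rangle=\int_{\mathbb X}fg\,dx$ is the martingale transform with blocks $T_I^*$. $M_b f=bf$ and $[M_b,T]=M_bT-TM_b$; it is bounded in $L^p$ with norm $N$ if $N$ is the smallest constant such that $|\langle bTf,g\rangle-\langle bf,T^*g\rangle|\le N\|f\|_p\|g\|_{p'}$ for all finite sums $f,g$ ($1/p+1/p'=1$). Mixing. An interval $I\in\mathcal L$ with parent $I'$ is $(p,\varepsilon,K)$ non-degenerate for $T$ if there is $h=h_{I'}\in D_{I'}$ such that (i) $\|h\|_p=1$; (ii) $h|_I=0$; (iii) $\|\mathbf 1_I T_{I'}h\|_p\ge\varepsilon$; (iv) $\|h\|_\infty\le K|I'|^{-1/p}$ if $|I|<|I'|/K$. $T$ is strongly $(p,\varepsilon,K)$ mixing if every $I\in\mathcal L$ having a parent is $(p,\varepsilon,K)$ non-degenerate for $T$. $T$ is weakly $(p,\varepsilon,K)$ mixing if every $I\in\mathcal L$ having a parent is either $(p,\varepsilon,K)$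 non-degenerate for $T$ or $(p',\varepsilon,K)$ non-degenerate for $T^*$. Here $\varepsilon>0$ and $K<\infty$ are constants. BMO. For a formal sum $f=\sum_{I\in\mathcal L}\Delta_I f$ with $\Delta_I f\in D_I$, let $x_J$ be the value of $\Delta_I f$ on $J$ when $J$ is a child of $I$ (and $x_J=0$ if $J$ has no parent). Then $f\in\mathcal{BMO}_2$ if $\|f\|_{\mathcal{BMO}}:=\sup_{J\in\mathcal L}\bigl(\frac1{|J|}\sum_{I\in\mathcal L,\,I\subset J}|x_I|^2|I|\bigr)^{1/2}<\infty$. *)

(* Defs.v *)
From HB Require Import structures.
From mathcomp Require Import all_boot all_order all_algebra.
From mathcomp Require Import all_classical all_reals all_analysis.

Set Implicit Arguments.
Unset Strict Implicit.
Unset Printing Implicit Defensive.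

Import Order.TTheory GRing.Theory Num.Theory.
Import numFieldNormedType.Exports.

Local Open Scope classical_set_scope.
Local Open Scope ring_scope.

(* Functions on X are represented by functions R -> R; b is used only through
   its restriction to X, and all other functions below vanish outside X. *)

(* The generations are part of the data: the rank of an interval depends on
   them.  An interval may belong to several consecutive generations. *)
Record lattice (R : realType) (X : set R) := Lattice {
  gen :> int -> set (set R);
  gen_itv : forall k I, gen k I -> exists a c : R, a < c /\ I = [set` `[a, c[%R];
  gen_disjoint : forall k, trivIset (gen k) id;
  gen_cover : forall k, \bigcup_(I in gen k) I = X;
  gen_refine : forall k I, gen k I ->
    exists F : set (set R),
      [/\ finite_set F, F `<=` gen (k + 1) & I = \bigcup_(J in F) J] }.

Section MartingaleTransforms.
Variables (R : realType) (X : set R) (L : lattice X).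

Local Notation mu := (@lebesgue_measure R).

Definition len (I : set R) : R := fine (mu I).

Definition intervals : set (set R) := [set I | exists k, L k I].

Definition is_rank (I : set R) (k : int) : Prop :=
  L k I /\ forall m, L m I -> m <= k.

(* Empty when I has no rank, i.e. when I is in L_k for all large k. *)
Definition children (I : set R) : set (set R) :=
  [set J | exists k, [/\ is_rank I k, L (k + 1) J & J `<=` I]].

Definition has_parent (J : set R) : Prop :=
  exists2 I, intervals I & children I J.

Definition chain (I : int -> set R) : Prop :=
  forall k, L k (I k) /\ I k `<=` I (k - 1).

Definition A0 : set (set R) :=
  [set A | exists2 I, chain I & A = \bigcup_k I k].

Definition A0fin : set (set R) := [set A | A0 A /\ (mu A < +oo)%E].

(* The standing assumption on functions. *)
Definition admissible (f : R -> R) : Prop :=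
  measurable_fun X f /\
  forall I, chain I ->
    forall x y, (\bigcap_k I k) x -> (\bigcap_k I k) y -> f x = f y.

Definition loc_integrable (f : R -> R) : Prop :=
  forall I, intervals I -> mu.-integrable I (EFin \o f).

Definition average (f : R -> R) (I : set R) : R :=
  (len I)^-1 * \int[mu]_(x in I) f x.

Definition expect (I : set R) (f : R -> R) : R -> R :=
  fun x => average f I * \1_I x.

(* The sum is finite, since an interval has finitely many children. *)
Definition Delta (I : set R) (f : R -> R) : R -> R :=
  if `[< children I !=set0 >]
  then fun x => \sum_(J \in children I) expect J f x - expect I f x
  else fun=> 0.

Definition DI (I : set R) : set (R -> R) :=
  [set Delta I f | f in [set f : R -> R |
    measurable_fun X f /\ finite_norm mu 2%:E (f \_ X)]].

Definition norm_p (p : \bar R) (f : R -> R) : \bar R := 'N[mu]_p[EFin \o f].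

Definition pairing (f g : R -> R) : R := \int[mu]_(x in X) (f x * g x).

(* \sum_(i \in A) denotes 0 on infinite supports, whence the finiteness
   conditions.  The equation makes f bounded with support of finite measure. *)
Definition finite_sum (f : R -> R) : Prop :=
  [/\ finite_set [set I | intervals I /\ Delta I f <> (fun=> 0)],
      finite_set [set I | A0fin I /\ expect I f <> (fun=> 0)] &
      f = fun x => \sum_(I \in intervals) Delta I f x +
                   \sum_(I \in A0fin) expect I f x].

(* A family of blocks; T I matters only on DI I. *)
Definition blocks := set R -> (R -> R) -> (R -> R).

Definition martingale_transform (T : blocks) : Prop :=
  forall I, intervals I ->
    (forall h, DI I h -> DI I (T I h)) /\
    (forall (a : R) h k, DI I h -> DI I k ->
       T I (fun x => a * h x + k x) = fun x => a * T I h x + T I k x).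

Definition apply_mt (T : blocks) (f : R -> R) : R -> R :=
  fun x => \sum_(I \in intervals) T I (Delta I f) x.

(* T_I^* g is the element of D_I representing h |-> <T_I h, g> on D_I; it
   exists and is unique for g in D_I because D_I is finite-dimensional. *)
Definition adjoint (T : blocks) : blocks := fun I g =>
  xget (fun=> 0) [set k | DI I k /\
    forall h, DI I h -> pairing (T I h) g = pairing h k].

Definition conj_exp (p : R) : R := p / (p - 1).

Definition block_norm (p : R) (T : blocks) (I : set R) : \bar R :=
  ereal_sup [set norm_p p%:E (T I h) | h in
    [set h | DI I h /\ (norm_p p%:E h <= 1)%E]].

Definition blocks_norm (p : R) (T : blocks) : \bar R :=
  ereal_sup [set block_norm p T I | I in intervals].

Definition comm_form (b : R -> R) (T : blocks) (f g : R -> R) : R :=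
  pairing (fun x => b x * apply_mt T f x) g -
  pairing (fun x => b x * f x) (apply_mt (adjoint T) g).

Definition comm_bounded_by (p : R) (b : R -> R) (T : blocks) (N : R) : Prop :=
  0 <= N /\ forall f g, finite_sum f -> finite_sum g ->
    (`|comm_form b T f g|%:E <=
      N%:E * norm_p p%:E f * norm_p (conj_exp p)%:E g)%E.

Definition comm_norm (p : R) (b : R -> R) (T : blocks) : \bar R :=
  ereal_inf [set N%:E | N in comm_bounded_by p b T].

(* I' is the parent of I. *)
Definition nondegenerate_at (p eps K : R) (T : blocks) (I' I : set R) : Prop :=
  exists h, [/\ DI I' h,
    norm_p p%:E h = 1%E,
    forall x, I x -> h x = 0,
    (eps%:E <= norm_p p%:E (fun x => (\1_I x * T I' h x)%R))%E &
    len I < len I' / K -> (norm_p +oo%E h <= (K * len I' `^ (- p^-1))%:E)%E].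

Definition strongly_mixing (p eps K : R) (T : blocks) : Prop :=
  forall I' I, intervals I' -> intervals I -> children I' I ->
    nondegenerate_at p eps K T I' I.

Definition weakly_mixing (p eps K : R) (T : blocks) : Prop :=
  forall I' I, intervals I' -> intervals I -> children I' I ->
    nondegenerate_at p eps K T I' I \/
    nondegenerate_at (conj_exp p) eps K (adjoint T) I' I.

(* A formal sum is given by the family of its terms d I. *)
Definition formal_sum (d : set R -> R -> R) : Prop :=
  forall I, intervals I -> DI I (d I).

Definition jump (d : set R -> R -> R) (J : set R) : R :=
  xget 0 [set c | exists I, [/\ intervals I, children I J &
                                forall x, J x -> d I x = c]].

Definition bmo_norm (d : set R -> R -> R) : \bar R :=
  ereal_sup [set
    (((len J)^-1%:E *
      \esum_(I in [set I | intervals I /\ I `<=` J])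
         (`|jump d I| ^+ 2 * len I)%R%:E) `^ (2^-1)%R)%E | J in intervals].

Definition in_bmo (d : set R -> R -> R) : Prop :=
  formal_sum d /\ (bmo_norm d < +oo)%E.

Definition btilde0 (b : R -> R) : set R -> R -> R := fun I =>
  if `[< A0fin I >] then fun=> 0 else Delta I b.

End MartingaleTransforms.

(* Main.v *)
Require Import Defs.
From HB Require Import structures.
From mathcomp Require Import all_boot all_order all_algebra.
From mathcomp Require Import all_classical all_reals all_analysis.
From mathcomp Require Import ring lra measurable_realfun ess_sup_inf.
Import Order.TTheory GRing.Theory Num.Theory.
Import numFieldNormedType.Exports.
Local Open Scope classical_set_scope.
Local Open Scope ring_scope.

(** Let [J] be a child of [I] and let [h] witness that [J] is non-degenerate:
    [h = 0] on [J], and [T_I h] is a constant of size at least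
    [eps |J|^(-1/p)] on [J].  If [g] is a finite sum of differences supported
    in [J], then so is [T^* g]; hence [<b h, T^* g> = 0], and the commutator
    bound for [(h, g)] bounds [<b, g>] by [(N / eps) |J|^(1/p) ||g||_q], where
    [1/p + 1/q = 1].  By duality, [b] has bounded mean oscillation on every
    interval that has a parent.

    Next, the jump of [b] from [I] to [J] is bounded when [I] has a parent.
    If [J] is not small compared to [I], this is the oscillation bound on [I];
    otherwise the commutator is tested on [h] and on [1_J] corrected to mean
    zero, and the condition on [||h||_oo] controls the error terms.

    Finally, a John-Nirenberg stopping time argument for martingales with
    bounded jumps turns the [L^1] oscillation bound into an [L^2] one.  The
    intervals without a parent are elements of [A0fin], so the jumps from them
    to their children do not occur in [btilde0]. *)

Set Implicit Arguments.
Unset Strict Implicit.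
Unset Printing Implicit Defensive.

(** As no boundedness of [T] is assumed, the test pairs are step functions on the pieces of one
    generation inside one interval. Integrals, norms and pairings become finite sums weighted by
    lengths, and Hoelder's inequality and duality are proved for such sums. Every test function has
    mean zero on its interval, so functions are recentered repeatedly, each time at the cost of a
    factor 4.

    Two obstacles shape the argument. The oscillation bound on I controls the jump to a child J only
    up to a factor (|I| / |J|)^(1/p), which is useless for tiny J; the second commutator test pays
    for this, with b replaced by b minus its mean on I, a change that the relation <T_I h, g> = <h,
    T_I^* g> makes invisible. And nothing is known about convergence in L^2, so the last step bounds
    the variance of b averaged over generation m, uniformly in m, and only finite families of
    intervals are summed. *)

Section WeightedSums.

(** * Weighted finite sums: Hoelder, centering and duality *)

Variables (R : realType) (I : eqType) (s : seq I) (l : I -> R).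
Hypothesis l_gt0 : forall i, i \in s -> 0 < l i.
Implicit Types (p q M N B K : R) (x y u f g h k beta : I -> R).

(** The L^p norm of a function with value [x i] on disjoint pieces of length [l i]; [norm_step]
    makes the link. *)
Definition wnorm p x : R := (\sum_(i <- s) l i * `|x i| `^ p) `^ p^-1.

Local Notation tot := (\sum_(i <- s) l i).

Definition center x : I -> R :=
  fun i => x i - (\sum_(j <- s) l j * x j) / tot.

Lemma wsum_ge0 x : (forall i, i \in s -> 0 <= x i) ->
  0 <= \sum_(i <- s) l i * x i.
Proof.
move=> x0; rewrite big_seq_cond; apply: sumr_ge0 => i; rewrite andbT => si.
by rewrite mulr_ge0 ?x0// ltW// l_gt0.
Qed.

Lemma wsum_le x y : (forall i, i \in s -> x i <= y i) ->
  \sum_(i <- s) l i * x i <= \sum_(i <- s) l i * y i.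
Proof.
move=> xy; rewrite big_seq_cond [leRHS]big_seq_cond.
by apply: ler_sum => i; rewrite andbT => si; rewrite ler_wpM2l ?xy// ltW ?l_gt0.
Qed.

Lemma ler_norm_wsum x : `|\sum_(i <- s) l i * x i| <= \sum_(i <- s) l i * `|x
  i|.
Proof.
apply: (le_trans (ler_norm_sum _ _ _));
  rewrite big_seq_cond [leRHS]big_seq_cond.
apply: ler_sum => i; rewrite andbT => si.
by rewrite normrM (gtr0_norm (l_gt0 si)).
Qed.

Lemma wsum_powR_ge0 p x : 0 <= \sum_(i <- s) l i * `|x i| `^ p.
Proof. by apply: wsum_ge0 => i _; exact: powR_ge0. Qed.

Lemma wnorm_ge0 p x : 0 <= wnorm p x.
Proof. exact: powR_ge0. Qed.

Lemma wnorm_powR p x : 0 < p ->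
  (wnorm p x) `^ p = \sum_(i <- s) l i * `|x i| `^ p.
Proof.
by move=> p0; rewrite /wnorm -powRrM mulVf ?gt_eqF// powRr1// wsum_powR_ge0.
Qed.

Lemma eq_wnorm p x y : (forall i,
  i \in s -> x i = y i) -> wnorm p x = wnorm p y.
Proof. by move=> xy; congr (_ `^ _); apply: eq_big_seq => i /xy ->. Qed.

Lemma wsum_powR_eq0 p x : 0 < p -> \sum_(i <- s) l i * `|x i| `^ p = 0 ->
  forall i, i \in s -> x i = 0.
Proof.
move=> p0 /eqP; rewrite big_seq_cond psumr_eq0; last first.
  by move=> i; rewrite andbT => si; rewrite mulr_ge0 ?powR_ge0// ltW// l_gt0.
move=> /allP + i si => /(_ i si); rewrite si/= mulf_eq0 (gt_eqF (l_gt0 si))/=.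
by rewrite powR_eq0 normr_eq0 (gt_eqF p0)/= andbT => /eqP.
Qed.

Lemma wnormZ p (c : R) x : 0 < p -> wnorm p (fun i => c * x i) = `|c| * wnorm p
  x.
Proof.
move=> p0; rewrite /wnorm.
under eq_bigr do rewrite normrM powRM// mulrCA.
rewrite -mulr_sumr powRM ?powR_ge0 ?wsum_powR_ge0// -powRrM mulfV ?gt_eqF//.
by rewrite powRr1.
Qed.

(** Both factors are normalised to norm 1 and Young's inequality is summed; vanishing norms come
    first because the normalisation divides by them. *)
Lemma hoelder_wsum p q x y : 1 < p -> 1 < q -> p^-1 + q^-1 = 1 ->
  \sum_(i <- s) l i * (`|x i| * `|y i|) <= wnorm p x * wnorm q y.
Proof.
move=> p1 q1 pq; have p0 : 0 < p by lra.
have q0 : 0 < q by lra.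
have [A0|A0] := eqVneq (\sum_(i <- s) l i * `|x i| `^ p) 0.
  rewrite /wnorm A0 powR0 ?invr_eq0 ?gt_eqF// mul0r big_seq big1// => i si.
  by rewrite (wsum_powR_eq0 p0 A0 si) normr0 mul0r mulr0.
have [B0|B0] := eqVneq (\sum_(i <- s) l i * `|y i| `^ q) 0.
  rewrite {2}/wnorm B0 powR0 ?invr_eq0 ?gt_eqF// mulr0 big_seq big1// => i si.
  by rewrite (wsum_powR_eq0 q0 B0 si) normr0 mulr0 mulr0.
have gtA : 0 < wnorm p x.
  by rewrite powR_gt0// lt0r A0/= wsum_powR_ge0.
have gtB : 0 < wnorm q y.
  by rewrite powR_gt0// lt0r B0/= wsum_powR_ge0.
have wp := wnorm_powR x p0; have wq := wnorm_powR y q0.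
move: (wnorm p x) (wnorm q y) gtA gtB wp wq => A B gtA gtB wp wq.
have divE (a b r : R) : 0 <= a -> 0 <= b -> (a / b) `^ r = a `^ r / b `^ r.
  by move=> a0 b0; rewrite powRM ?invr_ge0// -powR_inv1// powRAC powR_inv1//
    powR_ge0.
rewrite -[A * B]mul1r -ler_pdivrMr ?mulr_gt0//.
have -> : (\sum_(i <- s) l i * (`|x i| * `|y i|)) / (A * B) =
    \sum_(i <- s) l i * ((`|x i| / A) * (`|y i| / B)).
  rewrite mulr_suml; apply: eq_bigr => i _.
  by rewrite invfM -!mulrA; do 2 congr (_ * _); rewrite mulrCA.
have -> : (1 : R) = (\sum_(i <- s) l i * `|x i| `^ p) / A `^ p / p +
     (\sum_(i <- s) l i * `|y i| `^ q) / B `^ q / q.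
  by rewrite wp wq !divff// !mul1r.
rewrite !mulr_suml -big_split/= big_seq [leRHS]big_seq.
apply: ler_sum => i si.
have := @conjugate_powR R (`|x i| / A) (`|y i| / B) p q
  (divr_ge0 (normr_ge0 _) (ltW gtA)) (divr_ge0 (normr_ge0 _) (ltW gtB)) p0 q0
    pq.
rewrite !divE ?(ltW gtA) ?(ltW gtB)// => h.
have := ler_wpM2l (ltW (l_gt0 si)) h.
by rewrite mulrDr !mulrA.
Qed.

Lemma wnorm_le p x (c : R) : 0 < p -> 0 <= c ->
  \sum_(i <- s) l i * `|x i| `^ p <= c `^ p -> wnorm p x <= c.
Proof.
move=> p0 c0 h; rewrite /wnorm -[leRHS](powRr1 c0) -(divff (lt0r_neq0 p0))
  powRrM.
by apply: ge0_ler_powR;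
  rewrite ?nnegrE ?invr_ge0 ?(ltW p0) ?wsum_powR_ge0 ?powR_ge0.
Qed.

Lemma wnorm_cst p (c : R) : 0 < p -> wnorm p (fun=> c) = `|c| * tot `^ p^-1.
Proof.
move=> p0; rewrite /wnorm -mulr_suml mulrC powRM ?powR_ge0//; last first.
  by rewrite big_seq; apply: sumr_ge0 => i si; rewrite ltW ?l_gt0.
by rewrite -powRrM mulfV ?gt_eqF// powRr1.
Qed.

Lemma powRD_le q (a b : R) : 0 < q -> 0 <= a -> 0 <= b ->
  (a + b) `^ q <= 2 `^ q * (a `^ q + b `^ q).
Proof.
move=> q0; wlog ab : a b / a <= b => [hw a0 b0|a0 b0].
  have [ab|ba] := leP a b; first exact: hw.
  by rewrite addrC [_ `^ q + _]addrC; apply: hw => //; exact: ltW.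
apply: (@le_trans _ _ ((2 * b) `^ q)).
  by apply: ge0_ler_powR; rewrite ?nnegrE ?(ltW q0) ?addr_ge0 ?mulr_ge0//; lra.
by rewrite powRM// ler_wpM2l ?powR_ge0// lerDr powR_ge0.
Qed.

Hypothesis s_neq0 : s != [::].

Lemma wtot_gt0 : 0 < tot.
Proof.
case: s s_neq0 l_gt0 => // i r _ h; rewrite big_cons ltr_pwDl ?h ?mem_head//.
by rewrite big_seq; apply: sumr_ge0 => j jr; rewrite ltW ?h// in_cons jr orbT.
Qed.

Lemma wsum_center x : \sum_(i <- s) l i * center x i = 0.
Proof.
under eq_bigr do rewrite mulrBr.
rewrite big_split/= sumrN -mulr_suml mulrC divfK ?subrr//.
by rewrite gt_eqF// wtot_gt0.
Qed.

Lemma wsum_mul_center x y : \sum_(i <- s) l i * x i = 0 ->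
  \sum_(i <- s) l i * (x i * center y i) = \sum_(i <- s) l i * (x i * y i).
Proof.
move=> x0; under eq_bigr do rewrite 2!mulrBr [l _ * (x _ * (_ / _))]mulrA.
by rewrite big_split/= sumrN -mulr_suml x0 mul0r subr0.
Qed.

(** The mean is bounded by Hoelder against the constant 1, and the crude [powRD_le] replaces
    Minkowski. The two terms add up to a factor 2 * 2^q, at most 4^q because q > 1. *)
Lemma wnorm_center p q x : 1 < p -> 1 < q -> p^-1 + q^-1 = 1 ->
  wnorm q (center x) <= 4 * wnorm q x.
Proof.
move=> p1 q1 pq; have p0 : 0 < p by lra.
have q0 : 0 < q by lra.
have T0 := wtot_gt0.
rewrite /center; set m := _ / _.
have mW : `|m| * tot `^ q^-1 <= wnorm q x.
  rewrite -(ler_pM2r (powR_gt0 p^-1 T0)) -mulrA -powRD; last first.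
    by rewrite (gt_eqF T0) implybT.
  rewrite addrC in pq; rewrite pq powRr1 ?(ltW T0)//.
  rewrite /m normrM normfV (gtr0_norm T0) divfK ?gt_eqF//.
  have := @hoelder_wsum q p x (fun=> 1) q1 p1 pq;
    rewrite wnorm_cst// normr1 mul1r.
  by apply: le_trans; under [leRHS]eq_bigr do rewrite mulr1;
    exact: ler_norm_wsum.
apply: wnorm_le => //; first by rewrite mulr_ge0 ?wnorm_ge0.
apply: (@le_trans _ _ (\sum_(i <- s) l i * (2 `^ q * (`|x i| `^ q + `|m| `^
  q)))).
  apply: wsum_le => i _;
    apply: le_trans (powRD_le q0 (normr_ge0 _) (normr_ge0 _)).
  by apply: ge0_ler_powR; rewrite ?nnegrE ?(ltW q0) ?addr_ge0// ler_normB.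
under eq_bigr do rewrite mulrDr mulrDr.
rewrite big_split/=.
have -> : \sum_(i <- s) l i * (2 `^ q * `|x i| `^ q) = 2 `^ q * (wnorm q x) `^
  q.
  by rewrite wnorm_powR// mulr_sumr; apply: eq_bigr => i _; rewrite mulrCA.
have h : \sum_(i <- s) l i * (2 `^ q * `|m| `^ q) <= 2 `^ q * (wnorm q x) `^ q.
  rewrite -mulr_suml mulrCA ler_wpM2l ?powR_ge0//.
  apply: le_trans (ge0_ler_powR (ltW q0) _ _ mW); rewrite ?nnegrE ?wnorm_ge0//;
    last first.
    by rewrite mulr_ge0 ?powR_ge0.
  by rewrite powRM ?powR_ge0// -powRrM mulVf ?gt_eqF// powRr1 ?(ltW T0)// mulrC.
apply: (le_trans (lerD (lexx _) h)).
rewrite powRM ?wnorm_ge0// -mulrDl ler_wpM2r ?powR_ge0//.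
rewrite (_ : (4 : R) = 2 * 2); last by lra.
rewrite powRM//; have : 2 `^ 1 <= 2 `^ q :> R by apply: ler_powR; lra.
rewrite powRr1// => h2; nra.
Qed.

(** The extremal function sign(k) |k|^(q-1) of Hoelder's inequality need not have mean zero.
    Centering it keeps its pairing with the mean-zero [k] and costs the factor 4. *)
Lemma wnorm_dual p q k M : 1 < p -> 1 < q -> p^-1 + q^-1 = 1 -> 0 <= M ->
  \sum_(i <- s) l i * k i = 0 ->
  (forall f, \sum_(i <- s) l i * f i = 0 ->
     `|\sum_(i <- s) l i * (f i * k i)| <= M * wnorm p f) ->
  wnorm q k <= 4 * M.
Proof.
move=> p1 q1 pq M0 k0 hk; have p0 : 0 < p by lra.
have q0 : 0 < q by lra.
pose f i := Num.sg (k i) * `|k i| `^ (q - 1).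
have fk : \sum_(i <- s) l i * (center f i * k i) = (wnorm q k) `^ q.
  rewrite wnorm_powR//.
  under eq_bigr do rewrite [_ * k _]mulrC.
  rewrite (wsum_mul_center _ k0); apply: eq_bigr => i _; congr (_ * _).
  by rewrite mulrCA mulrA -normrEsg mulr_powRB1.
have nf : wnorm p f <= (wnorm q k) `^ (q - 1).
  apply: wnorm_le => //; first exact: powR_ge0.
  have qp : (q - 1) * p = q.
    have : q * (p * (p^-1 + q^-1)) = q * p by rewrite pq mulr1.
    rewrite mulrDr divff ?gt_eqF// mulrDr mulr1 mulrCA divff ?gt_eqF//; lra.
  rewrite -powRrM qp wnorm_powR//; apply: wsum_le => i _.
  rewrite /f normrM normr_sg (ger0_norm (powR_ge0 _ _)) powRM ?powR_ge0//
    -powRrM qp.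
  have [->|ki] := eqVneq (k i) 0; last by rewrite powR1 mul1r.
  by rewrite powR0 ?gt_eqF// mul0r powR_ge0.
have [->|W0] := eqVneq (wnorm q k) 0; first by rewrite mulr_ge0.
have {}W0 : 0 < wnorm q k by rewrite lt0r W0 wnorm_ge0.
have := hk _ (wsum_center f); rewrite fk ger0_norm ?powR_ge0// => h.
have {h} : (wnorm q k) `^ q <= M * (4 * (wnorm q k) `^ (q - 1)).
  apply: (le_trans h); rewrite ler_wpM2l//.
  have qp : q^-1 + p^-1 = 1 by rewrite addrC.
  by apply: (le_trans (wnorm_center _ q1 p1 qp)); rewrite ler_wpM2l.
rewrite -(mulr_powRB1 (ltW W0) q0) mulrCA [_ * (M * _)]mulrA.
by rewrite ler_pM2r// powR_gt0.
Qed.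

Lemma wsum_pred1 j x : uniq s -> j \in s ->
  \sum_(i <- s) l i * ((i == j)%:R * x i) = l j * x j.
Proof.
move=> us js; rewrite (bigD1_seq j)//= eqxx mul1r big1 ?addr0// => i /negbTE ->.
by rewrite mul0r mulr0.
Qed.

End WeightedSums.

(* The test function [g] below is [1_j] minus a multiple of the indicator of a
   set of measure at least [tot / 2] on which [|u| <= 2 * B * tot `^ (- p^-1)];
   the commutator bound for the pair [(h, g)] isolates [beta j * u j]. *)
Lemma jump_bound (R : realType) (I : eqType) (s : seq I) (l : I -> R)
    (p q M N B K eps : R) (beta h u : I -> R) (j : I) :
  let tot := \sum_(i <- s) l i in
  (forall i, i \in s -> 0 < l i) ->
  1 < p -> 1 < q -> p^-1 + q^-1 = 1 ->
  0 <= M -> 0 <= N -> 0 < B -> 0 < K -> 0 < eps ->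
  uniq s -> j \in s ->
  \sum_(i <- s) l i * beta i = 0 ->
  (forall g, \sum_(i <- s) l i * g i = 0 ->
     `|\sum_(i <- s) l i * (beta i * g i)| <= M * tot `^ p^-1 * wnorm s l q g)
       ->
  \sum_(i <- s) l i * `|beta i| <= 2 * M * tot ->
  (forall g, \sum_(i <- s) l i * g i = 0 -> exists2 k,
    wnorm s l q k <= B * wnorm s l q g &
     `|\sum_(i <- s) l i * (beta i * (u i * g i)) -
       \sum_(i <- s) l i * (beta i * (h i * k i))| <= N * wnorm s l q g) ->
  wnorm s l p u <= B ->
  eps <= `|u j| * l j `^ p^-1 ->
  (l j < tot / K -> forall i, i \in s -> `|h i| <= K * tot `^ (- p^-1)) ->
  `|beta j| <= 4 * M * (K + 2) + (2 * N + 8 * M * K * B + 8 * M * B) / eps.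
Proof.
move=> tot l_gt0 p1 q1 pq M0 N0 B0 K0 eps0 us js beta0 O1 OL comm uB epsu hK.
have p0 : 0 < p by clear -p1; lra.
have q0 : 0 < q by clear -q1; lra.
have K2 : 0 <= K + 2 by clear -K0; lra.
have K21 : 1 <= K + 2 by clear -K0; lra.
have two_powR t : 1 < t -> 2 <= 2 `^ t :> R.
  by move=> t1; rewrite -[leLHS](powRr1 (ler0n _ 2)); apply: ler_powR;
    rewrite ?ler1n// ltW.
have s_neq0 : s != [::] by apply: contraTneq js => ->.
have T0 := wtot_gt0 l_gt0 s_neq0; rewrite -/tot in T0; have lj0 := l_gt0 _ js.
have second0 : 0 <= (2 * N + 8 * M * K * B + 8 * M * B) / eps.
  by rewrite divr_ge0 ?(ltW eps0)// !addr_ge0// !mulr_ge0// ltW.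
have first0 : 0 <= 4 * M * (K + 2) by rewrite !mulr_ge0.
have ljT : l j <= tot.
  rewrite /tot (bigD1_seq j)//= lerDl big_seq_cond;
    apply: sumr_ge0 => i /andP[si _].
  by rewrite ltW ?l_gt0.
move tE : tot T0 O1 OL hK ljT => T T0 O1 OL hK ljT.
have ljpq : l j = l j `^ p^-1 * l j `^ q^-1.
  by rewrite -powRD ?pq ?powRr1 ?(ltW lj0)// (gt_eqF lj0) implybT.
(* If [j] is large, [O1] tested on the centered indicator of [j] suffices. The threshold K + 2
   serves the small case twice: K gives the hypothesis of [hK], and 2 gives l_j <= T / 2, so that a
   set of measure T / 2 can compensate the indicator. *)
have [big|small] := leP T (l j * (K + 2)).
  rewrite -[leLHS]addr0; apply: lerD => //.
  pose d i : R := (i == j)%:R.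
  have := O1 _ (wsum_center l_gt0 s_neq0 d); rewrite (wsum_mul_center _ beta0).
  have -> : \sum_(i <- s) l i * (beta i * d i) = l j * beta j.
    by rewrite -(wsum_pred1 l beta us js); apply: eq_bigr => i _;
      congr (_ * _); rewrite mulrC.
  have nd : wnorm s l q d <= l j `^ q^-1.
    apply: (wnorm_le l_gt0) => //; first exact: powR_ge0.
    rewrite -powRrM mulVf ?gt_eqF// powRr1 ?(ltW lj0)//.
    rewrite -[leRHS]mulr1 -(wsum_pred1 l (fun=> 1) us js).
    apply: (wsum_le l_gt0) => i _; rewrite /d mulr1; case: eqP => _ /=.
      by rewrite normr1 powR1.
    by rewrite normr0 powR0 ?gt_eqF.
  rewrite normrM (gtr0_norm lj0) => h1.
  have h2 : l j * `|beta j| <= M * T `^ p^-1 * (4 * l j `^ q^-1).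
    apply: (le_trans h1); rewrite ler_wpM2l ?mulr_ge0 ?powR_ge0//.
    by apply: (le_trans (wnorm_center l_gt0 s_neq0 _ p1 q1 pq));
      rewrite ler_wpM2l.
  have h3 : T `^ p^-1 <= (K + 2) * l j `^ p^-1.
    apply: (@le_trans _ _ ((l j * (K + 2)) `^ p^-1)).
      apply: ge0_ler_powR; rewrite ?invr_ge0 ?(ltW p0)// ?nnegrE ?(ltW T0)//.
      by rewrite mulr_ge0// ltW.
    rewrite powRM ?(ltW lj0)//.
    rewrite mulrC ler_wpM2r ?powR_ge0//; apply: ler1_powR => //.
    by rewrite invf_le1// ltW.
  rewrite -(ler_pM2l lj0); apply: (le_trans h2).
  rewrite [in leRHS]ljpq.
  have Q0 := powR_ge0 (l j) q^-1.
  have : M * 4 * l j `^ q^-1 * T `^ p^-1 <=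
         M * 4 * l j `^ q^-1 * ((K + 2) * l j `^ p^-1).
    by rewrite ler_wpM2l// !mulr_ge0.
  by clear; move=> h4; lra.
rewrite -[leLHS]add0r; apply: lerD => //.
have small2 : l j * 2 <= T.
  by apply: le_trans (ltW small); rewrite ler_pM2l// lerDr ltW.
have smallK : l j < T / K.
  by rewrite ltr_pdivlMr//; apply: le_lt_trans small; rewrite ler_pM2l// lerDl.
have {}hK := hK smallK.
pose thr := 2 * B * T `^ (- p^-1).
have thr0 : 0 <= thr by rewrite !mulr_ge0 ?powR_ge0 ?ltW.
pose e i : R := (`|u i| <= thr)%R%:R.
have e0 i : 0 <= e i by rewrite /e ler0n.
have e1 i : e i <= 1 by rewrite /e lern1 leq_b1.
have e_idem i r : (e i * r) = if `|u i| <= thr then r else 0.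
  by rewrite /e; case: ifP => _; rewrite ?mul1r ?mul0r.
pose E := \sum_(i <- s) l i * e i.
have Tthr : thr `^ p * T = (2 * B) `^ p.
  rewrite /thr [(2 * B * _) `^ p]powRM ?mulr_ge0 ?powR_ge0 ?(ltW B0)// -powRrM
    mulNr mulVf ?gt_eqF//.
  by rewrite powR_inv1 ?(ltW T0)// divfK// gt_eqF.
(* Chebyshev: thr^p T = (2 B)^p while the sum of |u|^p is at most B^p, so |u| > thr on measure at
   most T / 2^p <= T / 2. *)
have ET : T <= 2 * E.
  have h1 : \sum_(i <- s) l i * ((1 - e i) * thr `^ p) <= B `^ p.
    apply: le_trans (ge0_ler_powR (ltW p0) _ _ uB);
      rewrite ?nnegrE ?wnorm_ge0 ?(ltW B0)//.
    rewrite (wnorm_powR l_gt0)//; apply: (wsum_le l_gt0) => i _; rewrite /e.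
    case: (leP `|u i| thr) => /= [_|lt]; first by rewrite subrr mul0r powR_ge0.
    rewrite subr0 mul1r; apply: ge0_ler_powR; rewrite ?nnegrE ?(ltW p0)//;
      exact: ltW.
  have h2 : \sum_(i <- s) l i * ((1 - e i) * thr `^ p) = (T - E) * thr `^ p.
    rewrite /E -tE -sumrB mulr_suml; apply: eq_bigr => i _; ring.
  rewrite h2 -(ler_pM2r T0) -mulrA Tthr powRM ?(ltW B0)// mulrCA in h1.
  have Bp : 0 < B `^ p by exact: powR_gt0.
  have two := two_powR _ p1.
  have [h3|lt] := leP (T - E) 0.
    by have := wsum_ge0 l_gt0 (fun i _ => e0 i); rewrite -/E; clear -h3; lra.
  have h3 : (T - E) * 2 * B `^ p <= T * B `^ p.
    rewrite [T * _]mulrC; apply: le_trans h1.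
    by rewrite [_ * 2]mulrC -mulrA ler_pM2r ?mulr_gt0.
  by rewrite ler_pM2r// in h3; clear -h3; lra.
have E0 : 0 < E by clear -ET T0; lra.
have ljE : l j <= E by clear -ET small2; lra.
(* This value gives [g] mean zero. Since r <= 1, |g|^q is at most the indicator of [j] plus r e,
   whence the q-th power of the norm of [g] is at most 2 l_j. *)
have [r rE] : exists r, r = l j / E by exists (l j / E).
have r1 : r <= 1 by rewrite rE ler_pdivrMr// mul1r.
have r0 : 0 <= r by rewrite rE divr_ge0// ltW.
pose g i : R := (i == j)%:R - r * e i.
have sum_d y : \sum_(i <- s) l i * ((i == j)%:R * y i) = l j * y j by exact:
  wsum_pred1.
have g0 : \sum_(i <- s) l i * g i = 0.
  under eq_bigr do rewrite mulrBr.
  rewrite sumrB; have := sum_d (fun=> 1).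
  under eq_bigr do rewrite mulr1.
  move=> ->; under eq_bigr do rewrite mulrCA.
  by rewrite -mulr_sumr -/E rE divfK ?gt_eqF// mulr1 subrr.
have ng : wnorm s l q g <= 2 * l j `^ q^-1.
  apply: (wnorm_le l_gt0) => //; first by rewrite mulr_ge0 ?powR_ge0.
  apply: (@le_trans _ _ (\sum_(i <- s) l i * ((i == j)%:R * 1 + r * e i))).
    apply: (wsum_le l_gt0) => i _; rewrite /g; have [_|_] := eqVneq i j;
      rewrite ?mul1r ?mul0r ?add0r.
      apply: (@le_trans _ _ 1); last by rewrite lerDl mulr_ge0.
      apply: (@le_trans _ _ (1 `^ q)); last by rewrite powR1.
      apply: ge0_ler_powR; rewrite ?nnegrE ?(ltW q0)//=.
      have := mulr_ge0 r0 (e0 i); have : r * e i <= 1 by rewrite mulr_ile1.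
      by move=> ? ?; rewrite ger0_norm ?subr_ge0// lerBlDr lerDl.
    rewrite normrN ger0_norm ?mulr_ge0//.
    have [->|re0] := eqVneq (r * e i) 0; first by rewrite powR0 ?gt_eqF.
    apply: ge1r_powR; last exact: ltW.
    by rewrite lt0r re0 mulr_ge0// mulr_ile1.
  under eq_bigr do rewrite mulrDr.
  rewrite big_split/= sum_d; under eq_bigr do rewrite mulrCA.
  rewrite -mulr_sumr -/E rE divfK ?gt_eqF// mulr1.
  rewrite powRM ?powR_ge0// -powRrM mulVf ?gt_eqF// powRr1 ?(ltW lj0)//.
  have two := two_powR _ q1.
  by rewrite -[l j + l j]mulr2n -[_ *+ 2]mulr_natl ler_pM2r.
have [k kB kN] := comm _ g0.
set X := \sum_(i <- s) l i * (beta i * (u i * g i)) in kN.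
set Y := \sum_(i <- s) l i * (beta i * (h i * k i)) in kN.
set Z := \sum_(i <- s) l i * (beta i * (u i * e i)).
have XE : X = l j * (beta j * u j) - r * Z.
  rewrite /X /Z -(sum_d (fun i => beta i * u i)) mulr_sumr -sumrB.
  by apply: eq_bigr => i _; rewrite /g; ring.
(* By [hK], multiplication by [h] costs K T^(-1/p), which cancels the T^(1/p) of [O1]. The product
   [h i * k i] is centered first, as [beta0] permits. *)
have YB : `|Y| <= 8 * M * K * B * l j `^ q^-1.
  rewrite /Y -(wsum_mul_center _ beta0).
  apply: (le_trans (O1 _ (wsum_center l_gt0 s_neq0 _))).
  have K'0 : 0 <= K * T `^ (- p^-1) by rewrite mulr_ge0 ?powR_ge0// ltW.
  have hk : wnorm s l q (fun i => h i * k i) <= K * T `^ (- p^-1) * wnorm s l q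
    k.
    move: (K * T `^ (- p^-1)) K'0 hK => K' K'0 hK.
    have wk := wnorm_ge0 s l q k.
    apply: (wnorm_le l_gt0 q0 (mulr_ge0 K'0 wk)).
    rewrite powRM// (wnorm_powR l_gt0)//.
    rewrite mulr_sumr big_seq [leRHS]big_seq; apply: ler_sum => i si.
    rewrite mulrCA ler_wpM2l ?(ltW (l_gt0 _ si))// normrM powRM//.
    rewrite ler_wpM2r ?powR_ge0//; apply: ge0_ler_powR;
      rewrite ?nnegrE ?(ltW q0)//.
    exact: hK.
  have hk2 : wnorm s l q (center s l (fun i => h i * k i)) <=
      4 * (K * T `^ (- p^-1) * (B * (2 * l j `^ q^-1))).
    apply: (le_trans (wnorm_center l_gt0 s_neq0 _ p1 q1 pq));
      rewrite ler_wpM2l//.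
    apply: (le_trans hk); rewrite ler_wpM2l//.
    by apply: (le_trans kB); rewrite ler_wpM2l// ltW.
  apply: (le_trans (ler_wpM2l _ hk2)); first by rewrite mulr_ge0 ?powR_ge0.
  have tt : T `^ p^-1 * T `^ (- p^-1) = 1.
    by rewrite powRN divff// gt_eqF// powR_gt0.
  rewrite [leLHS](_ : _ = 8 * M * K * B * l j `^ q^-1 * (T `^ p^-1 * T `^ (-
    p^-1))).
    by rewrite tt mulr1.
  by ring.
have ZB : `|Z| <= thr * (2 * M * T).
  apply: (le_trans (ler_norm_wsum l_gt0 _)).
  apply: (@le_trans _ _ (thr * \sum_(i <- s) l i * `|beta i|));
    last by rewrite ler_wpM2l.
  rewrite mulr_sumr; under [leRHS]eq_bigr do rewrite mulrCA.
  apply: (wsum_le l_gt0) => i _; rewrite normrM mulrC ler_wpM2r//.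
  rewrite normrM (ger0_norm (e0 i)) mulrC e_idem.
  by case: ifP.
(* With r <= 2 l_j / T the product carries l_j T^(-1/p), at most l_j^(1/q) because l_j <= T. *)
have rZ : `|r * Z| <= 8 * M * B * l j `^ q^-1.
  rewrite normrM (ger0_norm r0).
  have rT : r <= 2 * l j / T.
    rewrite rE ler_pdivrMr// mulrAC ler_pdivlMr//.
    by rewrite -mulrA mulrCA ler_pM2l.
  apply: (le_trans (ler_pM r0 (normr_ge0 _) rT ZB)).
  have -> : 2 * l j / T * (thr * (2 * M * T)) = 8 * M * B * (l j * T `^ (-
    p^-1)).
    by rewrite /thr; field; rewrite gt_eqF.
  rewrite ler_wpM2l ?mulr_ge0 ?(ltW B0)//.
  rewrite {1}ljpq mulrAC -[leRHS]mul1r ler_wpM2r ?powR_ge0//.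
  rewrite powRN ler_pdivrMr ?powR_gt0// mul1r.
  by apply: ge0_ler_powR;
    rewrite ?nnegrE ?invr_ge0 ?(ltW p0) ?(ltW T0) ?(ltW lj0).
have XB : `|X| <= 2 * N * l j `^ q^-1 + 8 * M * K * B * l j `^ q^-1.
  have -> : X = (X - Y) + Y by rewrite subrK.
  apply: (le_trans (ler_normD _ _)); apply: lerD => //.
  apply: (le_trans kN); rewrite -mulrA mulrCA ler_wpM2l//.
have main : l j * (`|beta j| * `|u j|) <=
    (2 * N + 8 * M * K * B + 8 * M * B) * l j `^ q^-1.
  have : l j * (beta j * u j) = X + r * Z by rewrite XE subrK.
  move=> /(congr1 (@Num.norm _ R)); rewrite normrM (gtr0_norm lj0) normrM => ->.
  by apply: (le_trans (ler_normD _ _)); clear -XB rZ; lra.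
rewrite ler_pdivlMr//.
have Q0 : 0 < l j `^ q^-1 by exact: powR_gt0.
rewrite -(ler_pM2r Q0); apply: le_trans main.
rewrite [X in _ <= X * _]ljpq.
rewrite [leRHS](_ : _ = `|beta j| * (`|u j| * l j `^ p^-1) * l j `^ q^-1);
  last by ring.
by rewrite ler_wpM2r ?powR_ge0// ler_wpM2l.
Qed.

(** * Nested generations, ranks and parents *)

Section LatticeOrder.
Variables (R : realType) (X : set R) (L : lattice X).
Implicit Types (A B I J : set R) (j k m : int).

Lemma gen_neq0 k I : L k I -> I !=set0.
Proof.
move=> /gen_itv[a [c [ac ->]]]; exists a.
by rewrite /= in_itv/= lexx.
Qed.

Lemma gen_meet k A B x : L k A -> L k B -> A x -> B x -> A = B.
Proof. by move=> LA LB Ax Bx; apply: (gen_disjoint LA LB); exists x. Qed.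

Lemma gen_subX k I : L k I -> I `<=` X.
Proof. by move=> LI x Ix; rewrite -(gen_cover L k); exists I. Qed.

Lemma gen_cell k x : X x -> exists2 I, L k I & I x.
Proof. by rewrite -{1}(gen_cover L k) => -[I LI Ix]; exists I. Qed.

(** Induction on the number of generations between: by refinement, the cell one generation above [B]
    that contains [x] contains [B]. *)
Lemma gen_nested k m A B x : k <= m -> L k A -> L m B -> A x -> B x -> B `<=` A.
Proof.
move=> km; have -> : m = k + `|m - k|%N%:Z by rewrite gez0_abs ?subr_ge0//
  subrKC.
elim: `|m - k|%N B => {km m} [|n IH] B LA.
  by rewrite addr0 => LB Ax Bx; rewrite (gen_meet LA LB Ax Bx).
rewrite -addn1 PoszD addrA => LB Ax Bx.
have [C LC Cx] := gen_cell (k + n) (gen_subX LB Bx).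
apply: (subset_trans _ (IH C LA LC Ax Cx)).
have [F [_ FL CF]] := gen_refine LC.
move: Cx; rewrite CF => -[J FJ Jx]; rewrite (gen_meet LB (FL _ FJ) Bx Jx).
exact: bigcup_sup.
Qed.

(** The generations of an interval form an interval of integers, so [rankP] can test a rank at k + 1
    alone. *)
Lemma gen_between k j m I : k <= j -> j <= m -> L k I -> L m I -> L j I.
Proof.
move=> kj jm LkI LmI; have [x Ix] := gen_neq0 LkI.
have [J LJ Jx] := gen_cell j (gen_subX LkI Ix).
suff <- : J = I by [].
apply/seteqP; split; first exact: (gen_nested kj LkI LJ Ix Jx).
exact: (gen_nested jm LJ LmI Jx Ix).
Qed.

Definition parts m J : set (set R) := [set I | L m I /\ I `<=` J].

Lemma parts_cover k m J x : k <= m -> L k J -> J x -> exists2 I,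
  parts m J I & I x.
Proof.
move=> km LJ Jx; have [I LI Ix] := gen_cell m (gen_subX LJ Jx).
by exists I => //; split => //; exact: (gen_nested km LJ LI Jx Ix).
Qed.

Lemma parts_self k J : L k J -> parts k J = [set J].
Proof.
move=> LJ; apply/seteqP; split=> [I [LI IJ]|I ->]; last by split.
by have [x Ix] := gen_neq0 LI; exact: (gen_meet LI LJ Ix (IJ _ Ix)).
Qed.

Lemma finite_parts k m J : k <= m -> L k J -> finite_set (parts m J).
Proof.
move=> km; have -> : m = k + `|m - k|%N%:Z by rewrite gez0_abs ?subr_ge0//
  subrKC.
move=> LJ; elim: `|m - k|%N => {km m} [|n IH].
  by rewrite addr0 parts_self//; exact: finite_set1.
rewrite -addn1 PoszD addrA.
apply: (@sub_finite_set _ _ (\bigcup_(I in parts (k + n) J) parts (k + n + 1)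
  I)).
  move=> I [LI IJ]; have [x Ix] := gen_neq0 LI.
  have kn : k <= k + n%:Z by rewrite lerDl.
  have [C [LC CJ] Cx] := parts_cover kn LJ (IJ _ Ix).
  exists C => //; split => //; apply: (gen_nested _ LC LI Cx Ix).
  by rewrite lerDl.
apply: bigcup_finite => // C [LC CJ].
have [F [fF FL CF]] := gen_refine LC.
apply: (sub_finite_set _ fF) => I [LI IC]; have [x Ix] := gen_neq0 LI.
have := IC _ Ix; rewrite {1}CF => -[D FD Dx].
by rewrite (gen_meet LI (FL _ FD) Ix Dx).
Qed.

Definition partseq m J : seq (set R) := finmap.enum_fset (fset_set (parts m J)).

Lemma partseqP k m J I : k <= m -> L k J -> (I \in partseq m J) <-> parts m J I.
Proof.
move=> km LJ; have e := in_fset_set (finite_parts km LJ) I.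
by split=> [h|/mem_set h]; [apply: set_mem; rewrite -e|rewrite -e in h].
Qed.

Lemma partseq_uniq m J : uniq (partseq m J).
Proof. exact: finmap.fset_uniq. Qed.

Lemma partseq_self k J : L k J -> partseq k J = [:: J].
Proof.
move=> LJ; apply: perm_small_eq => //; apply: uniq_perm => [|//|I];
  first exact: partseq_uniq.
rewrite inE; apply/idP/eqP => [/(partseqP _ (lexx k) LJ)|->].
  by rewrite parts_self.
by apply/(partseqP _ (lexx k) LJ); rewrite parts_self.
Qed.

(** Each piece of generation [m] lies in exactly one cell of the intermediate generation [j]. *)
Lemma big_partseq (V : nmodType) k j m J (phi : set R -> V) :
  k <= j -> j <= m -> L k J ->
  \sum_(I <- partseq m J) phi I =
  \sum_(C <- partseq j J) \sum_(I <- partseq m C) phi I.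
Proof.
move=> kj jm LJ; have km := le_trans kj jm.
transitivity (\sum_(I <- partseq m J) \sum_(C <- partseq j J | `[< I `<=` C >])
  phi I).
  apply: eq_big_seq => I /(partseqP _ km LJ)[LI IJ].
  have [x Ix] := gen_neq0 LI.
  have [C PC Cx] := parts_cover kj LJ (IJ _ Ix).
  have [LC CJ] := PC.
  rewrite big_mkcond/= (bigD1_seq C) ?partseq_uniq//=;
    last exact/(partseqP _ kj LJ).
  have IC := gen_nested jm LC LI Cx Ix.
  rewrite big1_seq ?addr0; first by case: asboolP.
  move=> D /andP[DC] /(partseqP _ kj LJ)[LD DJ]; case: asboolP => // ID.
  by rewrite (gen_meet LD LC (ID _ Ix) Cx) eqxx in DC.
rewrite (exchange_big_dep xpredT)//=;
  apply: eq_big_seq => C /(partseqP _ kj LJ)[LC CJ].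
rewrite -big_filter; apply: perm_big; apply: uniq_perm.
- by rewrite filter_uniq ?partseq_uniq.
- exact: partseq_uniq.
move=> I; rewrite mem_filter;
  apply/andP/idP => [[/asboolP IC /(partseqP _ km LJ)[LI _]]|].
  exact/(partseqP _ jm LC).
by move=> /(partseqP _ jm LC)[LI IC]; split;
  [exact/asboolP|apply/(partseqP _ km LJ); split => //; exact: subset_trans CJ].
Qed.

Lemma rankP k I : is_rank L I k <-> L k I /\ ~ L (k + 1) I.
Proof.
split=> [[LI h]|[LI nLI]]; split=> //.
  by move=> /h; rewrite gerDl.
move=> m LmI; rewrite leNgt; apply/negP => km; apply: nLI.
by apply: (gen_between _ _ LI LmI); rewrite ?lerDl// lezD1.
Qed.

Lemma children_parts k I : is_rank L I k -> children L I = parts (k + 1) I.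
Proof.
move=> rI; apply/seteqP; split=> [J [j [[LI mI] LJ JI]]|J [LJ JI]];
  last by exists k.
suff jk : j = k by split=> //; rewrite -jk.
by apply/eqP; rewrite eq_le mI ?(proj2 rI)//; case: rI.
Qed.

Lemma child_rank I J : children L I J -> exists k,
  is_rank L I k /\ parts (k + 1) I J.
Proof. by move=> [k [rI LJ JI]]; exists k. Qed.

Lemma parts_child k I J : L k I -> parts (k + 1) I J -> J <> I -> children L I
  J.
Proof.
move=> LI [LJ JI] nJI; exists k; split=> //; apply/rankP; split => // LI'.
by have [x Jx] := gen_neq0 LJ; apply: nJI;
  exact: (gen_meet LJ LI' Jx (JI _ Jx)).
Qed.

(** At equal ranks the parents meet, hence coincide. At ranks k < k', [J] is already in generation k
    + 1 <= k', so the parent of rank k' would equal [J] and survive into generation k' + 1.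
    Uniqueness makes [jump] well defined. *)
Lemma parent_uniq I I' J : children L I J -> children L I' J -> I = I'.
Proof.
wlog suff hw : I I' / forall k k', k <= k' ->
    is_rank L I k /\ parts (k + 1) I J -> is_rank L I' k' /\ parts (k' + 1) I'
      J -> I = I'.
  move=> /child_rank[k cI] /child_rank[k' cI'].
  by have [kk'|/ltW kk'] := leP k k'; [exact: hw kk' _ _|apply/esym;
    exact: hw kk' _ _].
move=> k k'; rewrite le_eqVlt => /predU1P[<-|kk'] [rI [LJ JI]] [rI' [LJ' JI']].
  have [x Jx] := gen_neq0 LJ.
  exact: (gen_meet (proj1 rI) (proj1 rI') (JI _ Jx) (JI' _ Jx)).
have [x Jx] := gen_neq0 LJ; have kk1 : k + 1 <= k' by rewrite lezD1.
have I'J := gen_nested kk1 LJ (proj1 rI') Jx (JI' _ Jx).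
have E : I' = J by apply/seteqP.
by have /rankP[_] := rI'; rewrite E.
Qed.

Lemma sub_child_level k m J I : L k J -> L m I -> I `<=` J -> I <> J -> k < m.
Proof.
move=> LJ LI IJ nIJ; rewrite ltNge; apply/negP => mk; apply: nIJ.
have [x Ix] := gen_neq0 LI; apply/seteqP; split => //.
exact: (gen_nested mk LI LJ Ix (IJ _ Ix)).
Qed.

(** Going up from [J], the first cell different from [J] would be its parent. So [J] is in all
    earlier generations and is the union of a chain that is constant up to [k]. *)
Lemma no_parent_A0 k J : L k J -> ~ has_parent L J -> A0 L J.
Proof.
move=> LJ npJ.
have up j : j <= k -> L j J.
  move=> jk; have -> : j = k - `|k - j|%N%:Z by rewrite gez0_abs ?subr_ge0//
    opprB addrCA subrr addr0.
  elim: `|k - j|%N => {jk j} [|n IH]; first by rewrite subr0.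
  have [x Jx] := gen_neq0 LJ.
  have [I LI Ix] := gen_cell (k - n.+1%:Z) (gen_subX LJ Jx).
  have e : k - n.+1%:Z + 1 = k - n%:Z by rewrite -addn1 PoszD opprD addrA subrK.
  have JI : J `<=` I by apply: (gen_nested _ LI IH Ix Jx);
    rewrite lerB// lez_nat.
  have [->//|nJI] := EM (J = I).
  exfalso; apply: npJ; exists I; first by exists (k - n.+1%:Z).
  by apply: (parts_child LI) => //; split => //; rewrite e.
have [x Jx] := gen_neq0 LJ; have Xx := gen_subX LJ Jx.
have /choice[c cP] : forall j, exists I, L j I /\ I x.
  by move=> j; have [I LI Ix] := gen_cell j Xx; exists I.
have cJ j : j <= k -> c j = J.
  by move=> jk; have [Lc cx] := cP j; exact: (gen_meet Lc (up _ jk) cx Jx).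
exists c.
  move=> j; have [Lc cx] := cP j; have [Lc' cx'] := cP (j - 1); split => //.
  by apply: (gen_nested _ Lc' Lc cx' cx); rewrite gerBl.
apply/seteqP; split => [y Jy|y [j _]]; first by exists k => //; rewrite cJ.
have [jk|kj] := leP j k; first by rewrite cJ.
have [Lc cx] := cP j.
exact: (gen_nested (ltW kj) LJ Lc Jx cx).
Qed.

(* A union of a chain meeting a lattice interval contains it, since the chain
   passes through the generation of that interval. *)
Lemma A0_meet k A I x : A0 L A -> L k I -> A x -> I x -> I `<=` A.
Proof.
move=> [c cL ->] LI [j _ cx] Ix;
  apply: subset_trans (bigcup_sup (i := Order.min j k) _) => //.
have cdec m n : m <= n -> c n `<=` c m.
  move=> mn; have -> : n = m + `|n - m|%N%:Z by rewrite gez0_abs ?subr_ge0//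
    subrKC.
  elim: `|n - m|%N => {mn n} [|n IH]; first by rewrite addr0.
  apply: (subset_trans _ IH).
  by have [_] := cL (m + n.+1%:Z); rewrite -addn1 PoszD addrA addrK.
apply: (gen_nested _ (proj1 (cL _)) LI _ Ix); first by rewrite ge_min lexx orbT.
by apply: cdec cx; rewrite ge_min lexx.
Qed.

End LatticeOrder.

(** * Integrals and norms of step functions as finite sums *)

Section StepFunctions.
Variables (R : realType) (X : set R) (L : lattice X).
Implicit Types (A B I J : set R) (j k m : int) (G H : set R -> R).
Local Notation mu := (@lebesgue_measure R).
Local Notation len := (@len R).

Lemma gen_measurable k I : L k I -> measurable I.
Proof. by move=> /gen_itv[a [c [_ ->]]]; exact: measurable_itv. Qed.

Lemma mu_gen k I : L k I -> mu I = (len I)%:E.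
Proof.
move=> /gen_itv[a [c [ac ->]]]; rewrite /len fineK//.
by rewrite lebesgue_measure_itv/= lte_fin ac.
Qed.

Lemma len_gt0 k I : L k I -> 0 < len I.
Proof.
move=> /gen_itv[a [c [ac ->]]]; rewrite /len lebesgue_measure_itv/= lte_fin ac.
by rewrite /= subr_gt0.
Qed.

Lemma integrable_gen_cst k I (r : R) : L k I -> mu.-integrable I (EFin \o cst
  r).
Proof.
move=> LI; rewrite (_ : EFin \o cst r = cst r%:E)//.
apply/integrableP; split; first exact: measurable_cst.
rewrite (_ : (fun x => _) = cst `|r|%:E)// integral_cst//.
  by rewrite [X in (_ * X)%E](mu_gen LI) -EFinM ltry.
exact: gen_measurable LI.
Qed.

Lemma Rintegral_gen_cst k I (r : R) : L k I -> \int[mu]_(x in I) r = r * len I.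
Proof. by move=> LI; rewrite Rintegral_cst//; exact: gen_measurable LI. Qed.

Lemma piecewiseE k m J (b phi : R -> R) G : k <= m -> L k J ->
  (forall x, ~ J x -> phi x = 0) ->
  (forall I x, parts L m J I -> I x -> phi x = G I * b x) ->
  phi = fun x => \sum_(I <- partseq L m J) G I * (b \_ I) x.
Proof.
move=> km LJ phi0 phiE; apply/funext => x.
have [Jx|nJx] := EM (J x); last first.
  rewrite phi0// big1_seq// => I /andP[_ /(partseqP _ km LJ)[LI IJ]].
  rewrite patchE; case: ifPn; last by rewrite mulr0.
  by move=> /set_mem/IJ.
have [I PI Ix] := parts_cover km LJ Jx.
rewrite (bigD1_seq I) ?partseq_uniq//=; last exact/(partseqP _ km LJ).
rewrite patchE mem_set// big1_seq ?addr0; first exact: phiE.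
move=> I' /andP[I'I /(partseqP _ km LJ)[LI' _]]; rewrite patchE.
case: ifPn; last by rewrite mulr0.
move=> /set_mem I'x; move: I'I; rewrite (gen_meet LI' (proj1 PI) I'x Ix).
by rewrite eqxx.
Qed.

(** The freedom in [Y] lets one formula serve integrals over [J], over [X] in [pairing], and over
    elements of [A0]. *)
Lemma integral_piecewise k m J (b phi : R -> R) G : k <= m -> L k J ->
  (forall x, ~ J x -> phi x = 0) ->
  (forall I x, parts L m J I -> I x -> phi x = G I * b x) ->
  (forall I, parts L m J I -> mu.-integrable I (EFin \o b)) ->
  mu.-integrable [set: R] (EFin \o phi) /\
  forall Y, J `<=` Y -> \int[mu]_(x in Y) phi x =
    \sum_(I <- partseq L m J) G I * \int[mu]_(x in I) b x.
Proof.
move=> km LJ phi0 phiE ib.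
suff [h1 h2] : mu.-integrable [set: R] (EFin \o phi) /\
    \int[mu]_x phi x = \sum_(I <- partseq L m J) G I * \int[mu]_(x in I) b x.
  split=> // Y JY; rewrite -h2 Rintegral_mkcond; congr Rintegral;
    apply/funext => x.
  rewrite patchE; case: ifPn => // /negP nYx; rewrite phi0// => /JY Yx.
  by apply: nYx; exact/mem_set.
rewrite (piecewiseE km LJ phi0 phiE) => {phi0 phiE phi}.
suff: forall s, {subset s <= partseq L m J} ->
    mu.-integrable [set: R] (EFin \o (fun x => \sum_(I <- s) G I * (b \_ I) x))
      /\
    \int[mu]_x (\sum_(I <- s) G I * (b \_ I) x) = \sum_(I <- s) G I *
      \int[mu]_(x in I) b x.
  exact.
elim=> [|I s IH] ss.
  split.
    rewrite (_ : EFin \o _ = cst 0%E); first exact: integrable0.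
    by apply/funext => x /=; rewrite big_nil.
  under eq_Rintegral do rewrite big_nil; rewrite big_nil.
  by rewrite Rintegral_cst// mul0r.
have [|i1 i2] := IH.
  by move=> D Ds; apply: ss; rewrite in_cons Ds orbT.
have /(partseqP _ km LJ) PI := ss _ (mem_head _ _).
have mI := gen_measurable (proj1 PI).
have iI : mu.-integrable [set: R] (EFin \o (b \_ I)).
  by rewrite -restrict_EFin;
    have [+ _] := @integrable_mkcond _ _ R mu I (EFin \o b) mI; apply;
      exact: ib.
have iGI : mu.-integrable [set: R] (EFin \o (fun x => G I * (b \_ I) x)).
  rewrite (_ : EFin \o _ = fun x => ((G I)%:E * (EFin \o (b \_ I)) x)%E)//.
  exact: integrableZl.
split.
  rewrite (_ : EFin \o _ = (EFin \o (fun x => G I * (b \_ I) x)) \+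
      (EFin \o (fun x => \sum_(I <- s) G I * (b \_ I) x))).
    exact: integrableD.
  by apply/funext => x /=; rewrite big_cons EFinD.
under eq_Rintegral do rewrite big_cons.
by rewrite big_cons RintegralD// i2 RintegralZl// -Rintegral_mkcond.
Qed.

Definition stepf m J G : R -> R := fun x => \sum_(I <- partseq L m J) G I *
  \1_I x.

Lemma stepf_in k m J G I x : k <= m -> L k J -> parts L m J I -> I x ->
  stepf m J G x = G I.
Proof.
move=> km LJ PI Ix; rewrite /stepf (bigD1_seq I) ?partseq_uniq//=; last first.
  exact/(partseqP _ km LJ).
rewrite indicE mem_set// mulr1 big1_seq ?addr0//.
move=> I' /andP[I'I /(partseqP _ km LJ)[LI' _]]; rewrite indicE.
case: (boolP (x \in I')) => [/set_mem I'x|]; last by rewrite mulr0.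
by move: I'I; rewrite (gen_meet LI' (proj1 PI) I'x Ix) eqxx.
Qed.

Lemma stepf_out k m J G x : k <= m -> L k J -> ~ J x -> stepf m J G x = 0.
Proof.
move=> km LJ nJx; rewrite /stepf big1_seq// => I /andP[_ /(partseqP _ km LJ)[_
  IJ]].
by rewrite indicE memNset ?mulr0// => /IJ.
Qed.

(** A relation rather than an equation with [stepf]: differences and images under blocks come as
    functions of another form, and [is_step_eq] identifies them. *)
Definition is_step m J (phi : R -> R) G : Prop :=
  (forall x, ~ J x -> phi x = 0) /\
  forall I x, parts L m J I -> I x -> phi x = G I.

Lemma is_step_stepf k m J G : k <= m -> L k J -> is_step m J (stepf m J G) G.
Proof.
by move=> km LJ; split=> [x|I x PI];
  [exact: (stepf_out _ km LJ)|exact: (stepf_in _ km LJ PI)].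
Qed.

Lemma is_step_eq k m J phi psi G : k <= m -> L k J ->
  is_step m J phi G -> is_step m J psi G -> phi = psi.
Proof.
move=> km LJ [p0 p1] [q0 q1]; apply/funext => x.
have [Jx|nJx] := EM (J x); last by rewrite p0// q0.
by have [I PI Ix] := parts_cover km LJ Jx; rewrite (p1 I)// (q1 I).
Qed.

Lemma integral_step_mul k m J (b phi : R -> R) G : k <= m -> L k J ->
  is_step m J phi G -> (forall I,
    parts L m J I -> mu.-integrable I (EFin \o b)) ->
  mu.-integrable [set: R] (EFin \o (fun x => b x * phi x)) /\
  forall Y, J `<=` Y -> \int[mu]_(x in Y) (b x * phi x) =
    \sum_(I <- partseq L m J) G I * \int[mu]_(x in I) b x.
Proof.
move=> km LJ [phi0 phiE] ib; apply: (integral_piecewise km LJ) => //.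
  by move=> x nJx; rewrite phi0// mulr0.
by move=> I x PI Ix; rewrite (phiE I)// mulrC.
Qed.

Lemma integral_step k m J phi G : k <= m -> L k J -> is_step m J phi G ->
  mu.-integrable [set: R] (EFin \o phi) /\
  forall Y, J `<=` Y -> \int[mu]_(x in Y) phi x =
    \sum_(I <- partseq L m J) len I * G I.
Proof.
move=> km LJ st.
have [|h1 h2] := @integral_step_mul k m J (cst 1) phi G km LJ st.
  by move=> I [LI _]; exact: integrable_gen_cst LI.
have e : (fun x => cst 1 x * phi x) = phi by apply/funext => x; rewrite mul1r.
rewrite e in h1 h2; split => // Y JY; rewrite h2//.
apply: eq_big_seq => I /(partseqP _ km LJ)[LI _].
by rewrite (Rintegral_gen_cst _ LI) mul1r mulrC.
Qed.

Lemma len_sum k m J : k <= m -> L k J ->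
  len J = \sum_(I <- partseq L m J) len I.
Proof.
move=> km LJ; have st : is_step m J \1_J (fun=> 1).
  split=> [x nJx|I x [_ IJ] Ix]; rewrite indicE; first by rewrite memNset.
  by rewrite mem_set//; exact: IJ.
have [_ /(_ J (@subset_refl _ J))] := integral_step km LJ st.
under [X in _ = X -> _]eq_bigr do rewrite mulr1.
move=> <-; rewrite -[LHS]mul1r -(Rintegral_gen_cst _ LJ).
by apply: eq_Rintegral => x xJ; rewrite indicE xJ.
Qed.

Lemma norm_step k m J phi G (q : R) : 0 < q -> k <= m -> L k J -> is_step m J
  phi G ->
  norm_p q%:E phi = (wnorm (partseq L m J) len q G)%:E.
Proof.
move=> q0 km LJ [phi0 phiE].
have st : is_step m J (fun x => `|phi x| `^ q) (fun I => `|G I| `^ q).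
  split=> [x nJx|I x PI Ix]; last by rewrite (phiE I).
  by rewrite phi0// normr0 powR0 ?gt_eqF.
have [h1 h2] := integral_step km LJ st.
rewrite /norm_p unlock.
rewrite (_ : (fun x => _) = EFin \o (fun x => `|phi x| `^ q)); last first.
  by apply/funext.
rewrite -[X in (X `^ _)%E]fineK; last exact: integrable_fin_num.
by rewrite -[fine _]/(Rintegral _ _ _) h2// poweR_EFin.
Qed.

End StepFunctions.

Lemma le_addz1 (k : int) : k <= k + 1.
Proof. by rewrite lerDl. Qed.

(** * The spaces D_I, their coordinates and their orthogonality *)

Section Differences.
Variables (R : realType) (X : set R) (L : lattice X).
Hypothesis mX : measurable X.
Implicit Types (A B I J : set R) (j k m : int) (G H : set R -> R).
Implicit Types (f g h d : R -> R).
Local Notation mu := (@lebesgue_measure R).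
Local Notation len := (@len R).
Local Notation ch k I := (partseq L (k + 1) I).

Local Hint Resolve le_addz1 : core.

Lemma partseq_len_gt0 k m J : k <= m -> L k J ->
  forall I, I \in partseq L m J -> 0 < len I.
Proof. by move=> km LJ I /(partseqP _ km LJ)[LI _]; exact: len_gt0 LI. Qed.

Lemma partseq_neq0 k m J : k <= m -> L k J -> partseq L m J != [::].
Proof.
move=> km LJ; have [x Jx] := gen_neq0 LJ.
have [I /(partseqP _ km LJ) sI _] := parts_cover km LJ Jx.
by apply: contraTneq sI => ->.
Qed.

Lemma children_neq0 k I : is_rank L I k -> children L I !=set0.
Proof.
move=> rI; have [x Ix] := gen_neq0 (proj1 rI).
have [J PJ _] := parts_cover (le_addz1 k) (proj1 rI) Ix.
by exists J; rewrite (children_parts rI).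
Qed.

Lemma Delta_step k I f : is_rank L I k ->
  is_step L (k + 1) I (Delta L I f) (fun J => average f J - average f I).
Proof.
move=> rI; have LI := proj1 rI; have kk := le_addz1 k.
rewrite /Delta asboolT; last exact: children_neq0 rI.
have e x : \sum_(J \in children L I) expect J f x = stepf L (k + 1) I (average
  f) x.
  rewrite (children_parts rI) fsbig_finite; last exact: finite_parts LI.
  by [].
split=> [x nIx|J x PJ Jx].
  by rewrite e (stepf_out _ kk LI)// /expect indicE memNset// mulr0 subr0.
rewrite e (stepf_in _ kk LI PJ Jx) /expect indicE mem_set ?mulr1//.
exact: (proj2 PJ).
Qed.

Lemma Delta_unranked I f : ~ (exists k,
  is_rank L I k) -> Delta L I f = (fun=> 0).
Proof.
move=> nr; rewrite /Delta asboolF// => -[J [k [rI _ _]]]; apply: nr.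
by exists k.
Qed.

Lemma integral_gen_sum k m J f : k <= m -> L k J ->
  mu.-integrable J (EFin \o f) ->
  \int[mu]_(x in J) f x = \sum_(I <- partseq L m J) \int[mu]_(x in I) f x.
Proof.
move=> km LJ intf; have intI I : parts L m J I -> mu.-integrable I (EFin \o f).
  move=> [LI IJ]; by apply: integrableS intf => //;
    [exact: gen_measurable LJ|exact: gen_measurable LI].
have [||_ /(_ J (@subset_refl _ J))] :=
    @integral_piecewise R X L k m J f (f \_ J) (fun=> 1) km LJ _ _ intI.
- by move=> x nJx; rewrite patchE memNset.
- by move=> I x [_ IJ] Ix; rewrite patchE mem_set ?mul1r//; exact: IJ.
under [X in _ = X -> _]eq_bigr do rewrite mul1r.
by move=> <-; apply: eq_Rintegral => x xJ; rewrite patchE xJ.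
Qed.

Lemma len_average k I f : L k I -> len I * average f I = \int[mu]_(x in I) f x.
Proof. by move=> LI; rewrite /average mulVKf// gt_eqF// (len_gt0 LI). Qed.

Lemma wsum_average k m J f : k <= m -> L k J -> mu.-integrable J (EFin \o f) ->
  \sum_(I <- partseq L m J) len I * average f I = len J * average f J.
Proof.
move=> km LJ intf; rewrite (len_average _ LJ) (integral_gen_sum km LJ intf).
by apply: eq_big_seq => I /(partseqP _ km LJ)[LI _]; exact: len_average LI.
Qed.

Lemma wsum_average_sub k m J f : k <= m -> L k J -> mu.-integrable J (EFin \o
  f) ->
  \sum_(I <- partseq L m J) len I * (average f I - average f J) = 0.
Proof.
move=> km LJ intf; under eq_bigr do rewrite mulrBr.
by rewrite sumrB (wsum_average km LJ intf) -mulr_suml -(len_sum km LJ) subrr.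
Qed.

Lemma average_cst k I f (c : R) : L k I -> (forall x,
  I x -> f x = c) -> average f I = c.
Proof.
move=> LI fc; rewrite /average.
have -> : \int[mu]_(x in I) f x = \int[mu]_(x in I) c.
  by apply: eq_Rintegral => x /set_mem; exact: fc.
by rewrite (Rintegral_gen_cst _ LI) mulrC mulfK// gt_eqF// (len_gt0 LI).
Qed.

(** On a set of finite length, |f| <= 1 + |f|^2. *)
Lemma integrable_L2 k I f : L k I -> measurable_fun X f ->
  finite_norm mu 2%:E (f \_ X) -> mu.-integrable I (EFin \o f).
Proof.
move=> LI mf nf; have mI := gen_measurable LI.
have mfI : measurable_fun I f by apply: measurable_funS mf => //;
  exact: gen_subX LI.
have mfX : measurable_fun [set: R] (f \_ X).
  exact/(measurable_restrictT f mX).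
have int2 : (\int[mu]_x ((`|(f \_ X) x| ^+ 2)%:E) < +oo)%E.
  move: nf; rewrite /finite_norm unlock.
  rewrite (_ : (fun x => _) = (fun x => (`|(f \_ X) x| ^+ 2)%:E)); last first.
    by apply/funext => x; rewrite /= powR_mulrn.
  by apply: lty_poweRy; rewrite invr_eq0 pnatr_eq0.
pose g x := `|(f \_ X) x| ^+ 2.
have mg : measurable_fun [set: R] g.
  by apply: measurable_funX; exact: measurableT_comp.
have mgI : measurable_fun I g by exact: measurable_funS mg.
have g0 x : 0 <= g x by exact: exprn_ge0.
apply/integrableP; split; first exact/measurable_EFinP.
apply: (@le_lt_trans _ _ (\int[mu]_(x in I) ((1 + g x)%:E))%E).
  apply: ge0_le_integral => //=.
  - by apply/measurable_EFinP; exact: measurableT_comp.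
  - by apply/measurable_EFinP; exact: measurable_funD.
  move=> x Ix; rewrite /g lee_fin patchE mem_set; last exact: gen_subX LI x Ix.
  by have : 0 <= `|f x| by []; nra.
under eq_integral do rewrite EFinD.
rewrite ge0_integralD//=; last 2 first.
  by move=> x _; rewrite lee_fin.
  exact/measurable_EFinP.
rewrite integral_cst// mul1e [X in (X + _)%E](mu_gen LI) lte_add_pinfty ?ltry//.
apply: le_lt_trans int2; apply: ge0_subset_integral => //.
- exact/measurable_EFinP.
- by move=> x _; rewrite lee_fin.
Qed.

(** Coordinates for D_I: when [k] is the rank of [I], [DI_dstep] and [dstep_DI] show that these are
    exactly its elements. *)
Definition dstep k I h G : Prop :=
  is_step L (k + 1) I h G /\ \sum_(J <- ch k I) len J * G J = 0.

Lemma DI_dstep k I h : is_rank L I k -> DI L I h -> exists G, dstep k I h G.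
Proof.
move=> rI [f [mf nf] <-]; eexists; split; first exact: Delta_step rI.
have LI := proj1 rI.
exact: (wsum_average_sub (le_addz1 k) LI (integrable_L2 LI mf nf)).
Qed.

Lemma average_step k m J h G I : k <= m -> L k J -> is_step L m J h G ->
  parts L m J I -> average h I = G I.
Proof. by move=> km LJ [_ hG] PI; apply: (average_cst (proj1 PI)) => x;
  exact: hG. Qed.

Lemma dstep_int0 k I h G : is_rank L I k -> dstep k I h G ->
  forall Y, I `<=` Y -> \int[mu]_(x in Y) h x = 0.
Proof.
by move=> rI [st h0] Y IY;
  have [_ ->//] := integral_step (le_addz1 k) (proj1 rI) st.
Qed.

Lemma integrable_sub J h : measurable J -> mu.-integrable [set: R] (EFin \o h)
  ->
  mu.-integrable J (EFin \o h).
Proof. by move=> mJ; apply: integrableS. Qed.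

Lemma Delta_dstep k I h G : is_rank L I k -> dstep k I h G -> Delta L I h = h.
Proof.
move=> rI ds; apply: (is_step_eq (le_addz1 k) (proj1 rI) (G := G));
  last exact: proj1 ds.
have [D0 D1] := Delta_step h rI; split=> // J x PJ Jx; rewrite (D1 J)//.
rewrite (average_step (le_addz1 k) (proj1 rI) (proj1 ds) PJ).
by rewrite /average (dstep_int0 rI ds)// mulr0 subr0.
Qed.

Lemma dstep_DI k I h G : is_rank L I k -> dstep k I h G -> DI L I h.
Proof.
move=> rI ds; exists h; last exact: Delta_dstep ds.
have LI := proj1 rI.
have [ih _] := integral_step (le_addz1 k) LI (proj1 ds).
split.
  have := measurable_int _ ih => /measurable_EFinP; exact: measurable_funS.
rewrite /finite_norm (_ : h \_ X = h).
  by rewrite -/(norm_p _ _) (norm_step _ (le_addz1 k) LI (proj1 ds)) ?ltry.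
apply/funext => x; rewrite patchE; case: ifPn => // /negP nXx.
by rewrite (proj1 (proj1 ds))// => /(gen_subX LI) Xx; apply: nXx; exact/mem_set.
Qed.

Lemma DI0 I : DI L I (fun=> 0).
Proof.
have [[k rI]|nr] := EM (exists k, is_rank L I k); last first.
  exists (fun=> 0); last exact: Delta_unranked.
  split; first exact: measurable_cst.
  rewrite /finite_norm (_ : _ \_ X = cst 0); last by apply/funext => x;
    rewrite patchE; case: ifP.
  by rewrite (_ : EFin \o cst 0 = cst 0%E)// Lnorm0 ?ltry.
apply: (@dstep_DI k I _ (fun=> 0) rI); split; first by split.
by rewrite big1// => J _; rewrite mulr0.
Qed.

Lemma DI_unranked I h : ~ (exists k,
  is_rank L I k) -> DI L I h -> h = (fun=> 0).
Proof. by move=> nr [f _ <-]; exact: Delta_unranked. Qed.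

Lemma DI_out I h x : DI L I h -> ~ I x -> h x = 0.
Proof.
have [[k rI]|nr] := EM (exists k, is_rank L I k);
  last by move=> /(DI_unranked nr) ->.
by move=> /(DI_dstep rI)[G [[h0 _] _]]; exact: h0.
Qed.

Lemma dstep_lin k I h d G H (a : R) : dstep k I h G -> dstep k I d H ->
  dstep k I (fun x => a * h x + d x) (fun J => a * G J + H J).
Proof.
move=> [[h0 h1] hs] [[d0 d1] dsm]; split; first split.
- by move=> x nIx; rewrite h0// d0// mulr0 addr0.
- by move=> J x PJ Jx; rewrite (h1 J)// (d1 J).
under eq_bigr do rewrite mulrDr mulrCA.
by rewrite big_split/= -mulr_sumr hs dsm mulr0 addr0.
Qed.

Lemma DI_lin I h d (a : R) : DI L I h -> DI L I d -> DI L I (fun x => a * h x +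
  d x).
Proof.
have [[k rI]|nr] := EM (exists k, is_rank L I k).
  move=> /(DI_dstep rI)[G hG] /(DI_dstep rI)[H dH].
  exact: (dstep_DI rI (dstep_lin a hG dH)).
move=> /(DI_unranked nr) -> /(DI_unranked nr) ->.
rewrite (_ : (fun _ => _) = fun=> 0); first exact: DI0.
by apply/funext => x; rewrite mulr0 addr0.
Qed.

Lemma Delta_DI I f : mu.-integrable I (EFin \o f) -> DI L I (Delta L I f).
Proof.
move=> intf; have [[k rI]|nr] := EM (exists k, is_rank L I k); last first.
  by rewrite Delta_unranked//; exact: DI0.
apply: (dstep_DI rI); split; first exact: Delta_step rI.
exact: (wsum_average_sub (le_addz1 k) (proj1 rI) intf).
Qed.

Lemma Delta_DI_id I h : DI L I h -> Delta L I h = h.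
Proof.
have [[k rI]|nr] := EM (exists k, is_rank L I k).
  by move=> /(DI_dstep rI)[G hG]; exact: Delta_dstep hG.
by move=> /(DI_unranked nr) ->; exact: Delta_unranked.
Qed.

(** Let k and m be the ranks of [I] and [J]. If m < k, then [J] and its children each contain [I] or
    miss it, so all averages vanish. If m > k, then [h] is constant on [J]. If m = k, then [J] and
    [I] are disjoint. *)
Lemma Delta_DI_neq I J h : DI L I h -> J <> I ->
  Delta L J h = (fun=> 0).
Proof.
move=> hI JI.
have [[k rI]|nr] := EM (exists k, is_rank L I k); last first.
  rewrite (DI_unranked nr hI).
  have [[k rJ]|nrJ] := EM (exists k, is_rank L J k); last exact: Delta_unranked.
  apply: (is_step_eq (le_addz1 k) (proj1 rJ) (G := fun=> 0)); last by split.
  have [D0 D1] := Delta_step (fun=> 0) rJ; split=> // C x PC Cx;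
    rewrite (D1 C)//.
  by rewrite (average_cst (proj1 PC) (c := 0))// (average_cst (proj1 rJ) (c :=
    0))// subrr.
have [[m rJ]|nrJ] := EM (exists k, is_rank L J k); last exact: Delta_unranked.
have [G hG] := DI_dstep rI hI; have LI := proj1 rI; have LJ := proj1 rJ.
have av0 j C : j <= k -> L j C -> average h C = 0.
  move=> jk LC; have [[x [Ix Cx]]|dis] := EM (exists x, I x /\ C x).
    rewrite /average (dstep_int0 rI hG) ?mulr0//.
    exact: (gen_nested jk LC LI Cx Ix).
  apply: (average_cst LC) => x Cx; rewrite (DI_out hI)// => Ix.
  by apply: dis; exists x.
have avc j C : k < j -> L j C -> exists c, forall x, C x -> h x = c.
  move=> kj LC; have kj1 : k + 1 <= j by rewrite lezD1.
  have [[x [Ix Cx]]|dis] := EM (exists x, I x /\ C x); last first.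
    exists 0 => x Cx; rewrite (DI_out hI)// => Ix.
    by apply: dis; exists x.
  have [D PD Dx] := parts_cover (le_addz1 k) LI Ix.
  exists (G D) => y Cy; apply: (proj2 (proj1 hG)) => //.
  exact: (gen_nested kj1 (proj1 PD) LC Dx Cx).
apply: (is_step_eq (le_addz1 m) LJ (G := fun=> 0)); last by split.
have [D0 D1] := Delta_step h rJ; split=> // C x PC Cx; rewrite (D1 C)//.
have [LC CJ] := PC.
have [mk|km] := ltP m k.
  by rewrite (av0 m J (ltW mk) LJ) (av0 (m + 1) C) ?subrr// lezD1.
move: km; rewrite le_eqVlt => /predU1P[km|km]; last first.
  have [c hc] := avc _ _ km LJ.
  by rewrite (average_cst LJ hc) (average_cst LC (c := c)) ?subrr// => y /CJ;
    exact: hc.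
have hJ0 y : J y -> h y = 0.
  move=> Jy; rewrite (DI_out hI)// => Iy; apply: JI.
  by rewrite -km in LJ; exact: (gen_meet LJ LI Jy Iy).
by rewrite (average_cst LJ hJ0) (average_cst LC (c := 0)) ?subrr// => y /CJ;
  exact: hJ0.
Qed.

Lemma A0_measurable A : A0 L A -> measurable A.
Proof.
move=> [c cL ->]; apply: countable_bigcupT_measurable; first exact: countableP.
by move=> j; exact: gen_measurable (proj1 (cL j)).
Qed.

(* This says that [g] is a finite sum of elements of spaces [DI L I] with
   [I `<=` J]. *)
Definition diff_sum J g : Prop :=
  [/\ mu.-integrable [set: R] (EFin \o g),
      finite_set [set I | intervals L I /\ Delta L I g <> (fun=> 0)],
      forall I, intervals L I -> Delta L I g <> (fun=> 0) -> I `<=` J,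
      forall A, A0 L A -> \int[mu]_(x in A) g x = 0 &
      g = fun x => \sum_(I \in intervals L) Delta L I g x].

Lemma diff_sum_finite_sum J g : diff_sum J g -> finite_sum L g.
Proof.
move=> [ig fg _ g0 gE].
have e0 A : A0fin L A -> expect A g = (fun=> 0).
  by move=> [aA _]; apply/funext => x;
    rewrite /expect /average g0// mulr0 mul0r.
split => //.
  rewrite (_ : [set _ | _] = set0)//.
  by apply/seteqP; split=> // A [aA] /(_ (e0 _ aA)).
rewrite {1}gE; apply/funext => x.
by rewrite [X in _ = _ + X]fsbig1 ?addr0// => A /e0 ->.
Qed.

Lemma diff_sum_DI I g : intervals L I -> DI L I g -> diff_sum I g.
Proof.
move=> iI gI; have D1 := Delta_DI_id gI.
have D0 J : intervals L J -> J <> I -> Delta L J g = (fun=> 0).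
  by move=> _; exact: Delta_DI_neq.
have onlyI J : intervals L J -> Delta L J g <> (fun=> 0) -> J = I.
  by move=> iJ; have [//|nJ] := EM (J = I); rewrite D0.
have i0 : mu.-integrable [set: R] (EFin \o g).
  have [[k rI]|nr] := EM (exists k, is_rank L I k); last first.
    rewrite (DI_unranked nr gI) (_ : EFin \o _ = cst 0%E)//; exact: integrable0.
  have [G hG] := DI_dstep rI gI.
  by have [] := integral_step (le_addz1 k) (proj1 rI) (proj1 hG).
split => //.
- apply: (@sub_finite_set _ _ [set I]); last exact: finite_set1.
  by move=> J [iJ nJ]; exact: onlyI.
- by move=> J iJ nJ; rewrite (onlyI J).
- move=> A aA; have [[x [Ix Ax]]|dis] := EM (exists x, I x /\ A x); last first.
    have -> : \int[mu]_(x in A) g x = \int[mu]_(x in A) 0.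
      apply: eq_Rintegral => x /set_mem Ax.
      by rewrite (DI_out gI)// => Ix; apply: dis; exists x.
    by rewrite Rintegral_cst ?mul0r//; exact: A0_measurable.
  have [[k rI]|nr] := EM (exists k, is_rank L I k); last first.
    by rewrite (DI_unranked nr gI) Rintegral_cst ?mul0r//; exact: A0_measurable.
  have [G hG] := DI_dstep rI gI.
  by rewrite (dstep_int0 rI hG)//; exact: (A0_meet aA (proj1 rI) Ax Ix).
- apply/funext => x; rewrite -(@fsbig_widen _ _ _ _ [set I])//.
  + by rewrite fsbig_set1 D1.
  + by move=> J ->.
  + by move=> J [iJ nJ] /=; rewrite D0.
Qed.

Lemma integrable_gen k I g : L k I -> mu.-integrable [set: R] (EFin \o g) ->
  mu.-integrable I (EFin \o g).
Proof. by move=> LI; apply: integrable_sub; exact: gen_measurable LI. Qed.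

Lemma average_add I f g : measurable I -> mu.-integrable I (EFin \o f) ->
  mu.-integrable I (EFin \o g) ->
  average (fun x => f x + g x) I = average f I + average g I.
Proof. by move=> mI i1 i2; rewrite /average RintegralD// mulrDr. Qed.

Lemma Delta_add I f g : mu.-integrable [set: R] (EFin \o f) ->
  mu.-integrable [set: R] (EFin \o g) ->
  Delta L I (fun x => f x + g x) = (fun x => Delta L I f x + Delta L I g x).
Proof.
move=> i1 i2; have [[k rI]|nr] := EM (exists k, is_rank L I k); last first.
  by rewrite !Delta_unranked//; apply/funext => x; rewrite addr0.
have LI := proj1 rI.
apply: (is_step_eq (le_addz1 k) LI (Delta_step _ rI)).
have [f0 f1] := Delta_step f rI; have [g0 g1] := Delta_step g rI.
split=> [x nIx|J x PJ Jx]; first by rewrite f0// g0// addr0.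
have [LJ JI] := PJ.
have mI := gen_measurable LI; have mJ := gen_measurable LJ.
rewrite (f1 J)// (g1 J)// !average_add//; try exact: integrable_sub.
by rewrite opprD addrACA.
Qed.

Lemma diff_sum_add J f g : diff_sum J f -> diff_sum J g ->
  diff_sum J (fun x => f x + g x).
Proof.
move=> [f1 f2 f3 f4 f5] [g1 g2 g3 g4 g5].
have Da I := @Delta_add I _ _ f1 g1.
have nz I : Delta L I (fun x => f x + g x) <> (fun=> 0) ->
    Delta L I f <> (fun=> 0) \/ Delta L I g <> (fun=> 0).
  move=> nz; have [e|] := EM (Delta L I f = (fun=> 0)); last by left.
  right => e'; apply: nz; rewrite Da e e'; apply/funext => x; exact: addr0.
(* Sums over [\in] need finite supports, so all three expansions are taken over the union of the
   supports of [f] and [g]. *)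
pose S := [set I | intervals L I /\ Delta L I f <> (fun=> 0)] `|`
          [set I | intervals L I /\ Delta L I g <> (fun=> 0)].
have finS : finite_set S by rewrite finite_setU.
split.
- rewrite (_ : EFin \o _ = (EFin \o f) \+ (EFin \o g))//; exact: integrableD.
- apply: (@sub_finite_set _ _ S) finS => I [iI /nz[nf|ng]]; by [left|right].
- by move=> I iI /nz[/(f3 _ iI)|/(g3 _ iI)].
- move=> A aA; have mA := A0_measurable aA.
  by rewrite RintegralD ?f4 ?g4 ?addr0//; exact: integrable_sub.
- rewrite {1}f5 {1}g5; apply/funext => x.
  have wid h : (forall I, Delta L I h <> (fun=> 0) ->
        Delta L I f <> (fun=> 0) \/ Delta L I g <> (fun=> 0)) ->
      \sum_(I \in intervals L) Delta L I h x = \sum_(I \in S) Delta L I h x.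
    move=> hfg; apply/esym/fsbig_widen => [I [[]|[]]//|I [iI nSI]] /=.
    have [->//|/hfg nD] := EM (Delta L I h = (fun=> 0)).
    by exfalso; apply: nSI; case: nD; [left|right].
  rewrite (wid f); last by move=> I; left.
  rewrite (wid g); last by move=> I; right.
  rewrite (wid (fun x => f x + g x))// -fsbig_split//.
  by apply: eq_fsbigr => I _; rewrite Da.
Qed.
End Differences.

(** * Test functions, martingale transforms and adjoints *)

Section FiniteSums.
Variables (R : realType) (X : set R) (L : lattice X).
Hypothesis mX : measurable X.
Implicit Types (A B C I J : set R) (j k m : int) (G H : set R -> R).
Implicit Types (f g h d : R -> R).
Local Notation mu := (@lebesgue_measure R).
Local Notation len := (@len R).
Local Notation ch k I := (partseq L (k + 1) I).

Lemma diff_sum_sub I J g : I `<=` J -> diff_sum L I g -> diff_sum L J g.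
Proof.
by move=> IJ [g1 g2 g3 g4 g5]; split => // C iC nC;
  exact: subset_trans (g3 _ iC nC) IJ.
Qed.

Lemma diff_sum0 k J : L k J -> diff_sum L J (fun=> 0).
Proof. by move=> LJ; apply: diff_sum_DI => //; [exists k|exact: DI0]. Qed.

Lemma diff_sum_sum (T : eqType) (s : seq T) (F : T -> R -> R) k J : L k J ->
  (forall i, i \in s -> diff_sum L J (F i)) ->
  diff_sum L J (fun x => \sum_(i <- s) F i x).
Proof.
move=> LJ; elim: s => [|i s IH] h.
  rewrite (_ : (fun x => _) = fun=> 0); first exact: diff_sum0 LJ.
  by apply/funext => x; rewrite big_nil.
rewrite (_ : (fun x => _) = (fun x => F i x + \sum_(i <- s) F i x)).
  apply: diff_sum_add; first by apply: h; exact: mem_head.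
  by apply: IH => j js; apply: h; rewrite in_cons js orbT.
by apply/funext => x; rewrite big_cons.
Qed.

(** Here [k] may fail to be the rank: if [I] survives into generation k + 1, it is its only piece,
    and mean zero forces [h] to vanish. *)
Lemma dstep_diff_sum k I h G : L k I -> dstep L k I h G -> diff_sum L I h.
Proof.
move=> LI ds; have [LI1|nLI1] := EM (L (k + 1) I); last first.
  have rI : is_rank L I k by exact/rankP.
  by apply: diff_sum_DI => //; [exists k|exact: dstep_DI ds].
have [[h0 h1] hs] := ds.
suff -> : h = fun=> 0 by exact: diff_sum0 LI.
move: hs; rewrite (partseq_self LI1) big_seq1 => /eqP.
rewrite mulf_eq0 (gt_eqF (len_gt0 LI))/= => /eqP GI.
apply/funext => x; have [Ix|nIx] := EM (I x); last exact: h0.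
by rewrite (h1 I)// parts_self.
Qed.

(** Telescoping over generations: subtracting the averages over the cells of the last but one
    generation leaves a one-generation mean-zero function on each cell, and the averages form a
    coarser step function, still of mean zero. *)
Lemma step_diff_sum k m J g G : k <= m -> L k J -> is_step L m J g G ->
  \sum_(I <- partseq L m J) len I * G I = 0 -> diff_sum L J g.
Proof.
move=> km; have -> : m = k + `|m - k|%N%:Z by rewrite gez0_abs ?subr_ge0//
  subrKC.
move=> LJ; elim: `|m - k|%N g G => {km m} [|n IH] g G.
  rewrite addr0 partseq_self// big_seq1 => -[g0 g1] /eqP.
  rewrite mulf_eq0 (gt_eqF (len_gt0 LJ))/= => /eqP GJ.
  rewrite (_ : g = fun=> 0); first exact: diff_sum0 LJ.
  apply/funext => x; have [Jx|nJx] := EM (J x); last exact: g0.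
  by rewrite (g1 J)// parts_self.
have kn : k <= k + n%:Z by rewrite lerDl.
rewrite -addn1 PoszD addrA; move: (k + n%:Z) kn IH => m km IH st Gs.
have mm := le_addz1 m.
pose avg C := (\sum_(I <- partseq L (m + 1) C) len I * G I) / len C.
have -> : g = fun x => \sum_(C <- partseq L m J) stepf L (m + 1) C (fun I => G
  I - avg C) x
                       + stepf L m J avg x.
  apply: (is_step_eq (le_trans km mm) LJ st); split=> [x nJx|I x [LI IJ] Ix].
    rewrite (stepf_out _ km LJ nJx) addr0 big1_seq// => C /andP[_ /(partseqP _
      km LJ)[LC CJ]].
    by rewrite (stepf_out _ mm LC)// => /CJ.
  have [C PC Cx] := parts_cover km LJ (IJ _ Ix); have [LC CJ] := PC.
  rewrite (stepf_in _ km LJ PC Cx) (bigD1_seq C) ?partseq_uniq//=;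
    last exact/(partseqP _ km LJ).
  have PI : parts L (m + 1) C I by split => //;
    exact: (gen_nested mm LC LI Cx Ix).
  rewrite (stepf_in _ mm LC PI Ix) big1_seq ?addr0 ?subrK// => D /andP[DC
    /(partseqP _ km LJ)[LD DJ]].
  rewrite (stepf_out _ mm LD)// => Dx; move: DC.
  by rewrite (gen_meet LD LC Dx Cx) eqxx.
apply: diff_sum_add.
  apply: (diff_sum_sum LJ) => C /(partseqP _ km LJ)[LC CJ].
  apply: (diff_sum_sub CJ); apply: (dstep_diff_sum LC); split;
    first exact: is_step_stepf mm LC.
  under eq_bigr do rewrite mulrBr.
  by rewrite sumrB -mulr_suml -(len_sum mm LC) /avg mulrC divfK ?subrr//
    gt_eqF// (len_gt0 LC).
apply: IH; first exact: is_step_stepf km LJ.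
rewrite -[RHS]Gs (big_partseq _ km mm LJ);
  apply: eq_big_seq => C /(partseqP _ km LJ)[LC _].
by rewrite /avg mulrC divfK// gt_eqF// (len_gt0 LC).
Qed.

Definition block_op (S : blocks R) : Prop := forall I, intervals L I ->
  (forall h, DI L I h -> DI L I (S I h)) /\ S I (fun=> 0) = (fun=> 0).

Lemma apply_mt_DI S I h : block_op S -> intervals L I -> DI L I h ->
  apply_mt L S h = S I h.
Proof.
move=> oS iI hI; apply/funext => x;
  rewrite /apply_mt -(@fsbig_widen _ _ _ _ [set I]).
- by rewrite fsbig_set1 (Delta_DI_id mX hI).
- by move=> J ->.
- by move=> J [iJ nJ] /=; rewrite (Delta_DI_neq mX hI nJ) (proj2 (oS _ iJ)).
Qed.

(** Every interval contributing to [g] lies in [J], and a block maps D_I into functions supported on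
    I. *)
Lemma apply_mt_out S J g x : block_op S -> diff_sum L J g -> ~ J x ->
  apply_mt L S g x = 0.
Proof.
move=> oS [ig _ gJ _ _] nJx; rewrite /apply_mt fsbig1// => I iI.
have [S1 S2] := oS _ iI.
have [->|nD] := EM (Delta L I g = (fun=> 0)); first by rewrite S2.
have [k LI] := iI.
apply: (DI_out mX (L := L) (I := I)); last by move=> /(gJ _ iI nD).
by apply/S1/Delta_DI => //; exact: integrable_gen LI ig.
Qed.

Lemma pairingC f g : pairing X f g = pairing X g f.
Proof. by apply: eq_Rintegral => x _; rewrite mulrC. Qed.

Lemma pairing_step k m J (b : R -> R) h g G H : k <= m -> L k J ->
  is_step L m J h G -> is_step L m J g H ->
  (forall I, parts L m J I -> mu.-integrable I (EFin \o b)) ->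
  pairing X (fun x => b x * h x) g =
  \sum_(I <- partseq L m J) len I * (average b I * (G I * H I)).
Proof.
move=> km LJ [h0 h1] [g0 g1] ib.
have st : is_step L m J (fun x => h x * g x) (fun I => G I * H I).
  by split=> [x nJ|I x PI Ix]; [rewrite h0// mul0r|rewrite (h1 I)// (g1 I)].
have [_ /(_ X (gen_subX LJ))] := integral_step_mul km LJ st ib.
rewrite /pairing; under eq_Rintegral do rewrite mulrA.
move=> ->; apply: eq_big_seq => I /(partseqP _ km LJ)[LI _].
by rewrite mulrA (len_average _ LI) mulrC.
Qed.

Lemma pairing_dstep k I h g G H : L k I -> dstep L k I h G -> dstep L k I g H ->
  pairing X h g = \sum_(J <- ch k I) len J * (G J * H J).
Proof.
move=> LI [sth _] [stg _].
have := @pairing_step _ _ _ (cst 1) _ _ _ _ (le_addz1 k) LI sth stg.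
rewrite (_ : (fun x => cst 1 x * h x) = h); last by apply/funext => x;
  rewrite mul1r.
move=> ->; last by move=> J [LJ _]; exact: integrable_gen_cst LJ.
apply: eq_big_seq => J /(partseqP _ (le_addz1 k) LI)[LJ _].
by rewrite (average_cst LJ (c := 1))// mul1r.
Qed.

Lemma pairing_linl I h d g (a : R) : intervals L I -> DI L I h -> DI L I d ->
  DI L I g ->
  pairing X (fun x => a * h x + d x) g = a * pairing X h g + pairing X d g.
Proof.
move=> [j Lj] hI dI gI; have [[k rI]|nr] := EM (exists k, is_rank L I k);
  last first.
  have p0 f : pairing X f (fun=> 0) = 0.
    rewrite /pairing; under eq_Rintegral do rewrite mulr0.
    by rewrite Rintegral_cst ?mul0r.
  by rewrite (DI_unranked nr gI) !p0 mulr0 addr0.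
have [G hG] := DI_dstep mX rI hI; have [H dH] := DI_dstep mX rI dI.
have [K gK] := DI_dstep mX rI gI; have LI := proj1 rI.
rewrite (pairing_dstep LI (dstep_lin a hG dH) gK) (pairing_dstep LI hG gK)
  (pairing_dstep LI dH gK).
by rewrite mulr_sumr -big_split/=; apply: eq_bigr => J _; ring.
Qed.

Section Adjoint.
Variable T : blocks R.
Hypothesis mT : martingale_transform L T.

Lemma mt_block_op : block_op T.
Proof.
move=> I iI; have [T1 T2] := mT iI; split => //.
have := T2 1 _ _ (DI0 L I) (DI0 L I).
rewrite (_ : (fun x : R => _) = fun=> 0); last by apply/funext => x;
  rewrite mul1r addr0.
move=> e; apply/funext => x; have := congr1 (@^~ x) e => /= /eqP.
by rewrite mul1r -subr_eq subrr => /eqP <-.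
Qed.

(** Riesz representation. The centered indicators [u J] of the children span D_I: when a mean-zero
    [h] is expanded with its own values as coefficients, the subtracted constants cancel. So the
    centered quotients <T_I u_J, g> / |J| represent the functional. *)
Lemma adjoint_exists I g : intervals L I -> DI L I g -> exists d, DI L I d /\
  forall h, DI L I h -> pairing X (T I h) g = pairing X h d.
Proof.
move=> iI gI; have [T1 T2] := mT iI; have [_ T0] := mt_block_op iI.
have [[k rI]|nr] := EM (exists k, is_rank L I k); last first.
  exists (fun=> 0); split; first exact: DI0.
  by move=> h hI; rewrite (DI_unranked nr hI) T0 (DI_unranked nr gI).
have LI := proj1 rI; have kk := le_addz1 k.
set s := ch k I.
have l0 : forall J, J \in s -> 0 < len J := partseq_len_gt0 kk LI.
have s0 : s != [::] := partseq_neq0 kk LI.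
pose c J := center s len (fun J' => (J' == J)%:R).
pose u J := stepf L (k + 1) I (c J).
have uds J : dstep L k I (u J) (c J).
  by split; [exact: is_step_stepf kk LI|exact: wsum_center].
have uI J : DI L I (u J) by exact: dstep_DI (uds J).
pose e J := pairing X (T I (u J)) g / len J.
pose d := stepf L (k + 1) I (center s len e).
have dds : dstep L k I d (center s len e).
  by split; [exact: is_step_stepf kk LI|exact: wsum_center].
exists d; split; first exact: dstep_DI dds.
move=> h hI; have [G hG] := DI_dstep mX rI hI.
have hE : h = fun x => \sum_(J <- s) G J * u J x.
  apply: (is_step_eq kk LI (proj1 hG)); split=> [x nIx|J x PJ Jx].
    by rewrite big1// => J _; rewrite /u (stepf_out _ kk LI nIx) mulr0.
  under eq_bigr do rewrite /u (stepf_in _ kk LI PJ Jx).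
  have sJ : J \in s by exact/(partseqP _ kk LI).
  rewrite /c /center; under eq_bigr do rewrite mulrBr.
  rewrite sumrB (bigD1_seq J) ?partseq_uniq//= eqxx mulr1 big1_seq ?addr0;
    last first.
    by move=> J' /andP[/negbTE]; rewrite eq_sym => ->; rewrite mulr0.
  rewrite [X in _ - X](_ : _ = (\sum_(J' <- s) len J' * G J') / \sum_(J' <- s)
    len J').
    by rewrite (proj2 hG) mul0r subr0.
  rewrite mulr_suml; apply: eq_big_seq => J' sJ'.
  have := wsum_pred1 len (j := J') (fun=> 1) (partseq_uniq _ _ _) sJ'.
  rewrite /= mulr1; under eq_bigr do rewrite mulr1.
  by move=> ->; rewrite mulrA [len J' * _]mulrC.
have lin (r : seq (set R)) : DI L I (fun x => \sum_(J <- r) G J * u J x) /\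
    pairing X (T I (fun x => \sum_(J <- r) G J * u J x)) g =
    \sum_(J <- r) G J * pairing X (T I (u J)) g.
  elim: r => [|J r [IH1 IH2]].
    rewrite (_ : (fun x : R => _) = fun=> 0); last by apply/funext => x;
      rewrite big_nil.
    split; first exact: DI0.
    rewrite T0 big_nil /pairing; under eq_Rintegral do rewrite mul0r.
    by rewrite Rintegral_cst ?mul0r.
  rewrite (_ : (fun x : R => _) = fun x => G J * u J x + \sum_(J <- r) G J * u
    J x); last first.
    by apply/funext => x; rewrite big_cons.
  split; first exact: DI_lin.
  rewrite T2// (pairing_linl _ iI)//; try by apply: T1.
  by rewrite IH2 big_cons.
rewrite {1}hE (proj2 (lin s)) (pairing_dstep LI hG dds) (wsum_mul_center _
  (proj2 hG)).
apply: eq_big_seq => J sJ; rewrite /e mulrCA [len J * _]mulrC divfK//.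
by rewrite gt_eqF// l0.
Qed.

Lemma adjointP I g : intervals L I -> DI L I g -> DI L I (adjoint L T I g) /\
  forall h, DI L I h -> pairing X (T I h) g = pairing X h (adjoint L T I g).
Proof.
by move=> iI gI; have [d dP] := adjoint_exists iI gI; rewrite /adjoint;
  case: xgetP => [//|/(_ d)].
Qed.

(** For a = T_I^* 0 one has <a, a> = <T_I a, 0> = 0, so [a] vanishes. *)
Lemma adjoint_block_op : block_op (adjoint L T).
Proof.
move=> I iI; split=> [h /(adjointP iI)[]//|].
have [aI aP] := adjointP iI (DI0 L I); set a := adjoint _ _ _ _ in aI aP *.
have [[k rI]|nr] := EM (exists k, is_rank L I k); last exact: DI_unranked aI.
have LI := proj1 rI; have kk := le_addz1 k.
have [G aG] := DI_dstep mX rI aI.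
have := aP _ aI; rewrite (pairing_dstep LI aG aG) /pairing.
under eq_Rintegral do rewrite mulr0.
rewrite Rintegral_cst// mul0r => /esym G0.
apply: (is_step_eq kk LI (proj1 aG)); split => // J x PJ _.
suff -> : G J = 0 by [].
apply: (@wsum_powR_eq0 R _ (ch k I) len (partseq_len_gt0 kk LI) 2 G) => //;
  last exact/(partseqP _ kk LI).
by rewrite -[RHS]G0; apply: eq_bigr => C _;
  rewrite powR_mulrn// real_normK ?num_real.
Qed.
End Adjoint.
End FiniteSums.

(** * From L^1 oscillation and bounded jumps to the Carleson condition *)

Section JohnNirenberg.
Variables (R : realType) (X : set R) (L : lattice X) (b : R -> R).
Hypothesis ib : loc_integrable L b.
Implicit Types (A B C I J : set R) (j k m : int) (c M : R).
Local Notation mu := (@lebesgue_measure R).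
Local Notation len := (@len R).
Local Notation a := (average b).

(** Integrals over [J] of |E_m b - c|^2 here and of |E_m b - c| in [osum], where E_m b is b averaged
    over the intervals of generation [m]. *)
Definition vsum m J c := \sum_(I <- partseq L m J) len I * (a I - c) ^+ 2.
Definition osum m J c := \sum_(I <- partseq L m J) len I * `|a I - c|.

Lemma gen_integrable k I : L k I -> mu.-integrable I (EFin \o b).
Proof. by move=> LI; apply: ib; exists k. Qed.

Lemma vsum_rec k m J c : k + 1 <= m -> L k J ->
  vsum m J c = \sum_(C <- partseq L (k + 1) J) vsum m C c.
Proof. by move=> km LJ; exact: big_partseq (le_addz1 k) km LJ. Qed.

Lemma osum_rec k m J c : k + 1 <= m -> L k J ->
  osum m J c = \sum_(C <- partseq L (k + 1) J) osum m C c.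
Proof. by move=> km LJ; exact: big_partseq (le_addz1 k) km LJ. Qed.

Lemma vsum_ge0 k m J c : k <= m -> L k J -> 0 <= vsum m J c.
Proof.
move=> km LJ; apply: (wsum_ge0 (partseq_len_gt0 km LJ)) => I _; exact: sqr_ge0.
Qed.

(** The cross term vanishes because [a J] is the weighted mean; this is the orthogonality of
    martingale increments. *)
Lemma vsum_shift k m J c : k <= m -> L k J ->
  vsum m J c = vsum m J (a J) + len J * (a J - c) ^+ 2.
Proof.
move=> km LJ; rewrite (len_sum km LJ) mulr_suml.
have h0 := congr1 ( *%R (2 * (a J - c))) (wsum_average_sub km LJ
  (gen_integrable LJ)).
transitivity (vsum m J (a J) + \sum_(I <- partseq L m J) len I * (a J - c) ^+ 2
  +
  2 * (a J - c) * \sum_(I <- partseq L m J) len I * (a I - a J)).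
  rewrite /vsum mulr_sumr -!big_split/=.
  by apply: eq_bigr => I _; ring.
by rewrite h0 mulr0 addr0.
Qed.

Lemma osum_ge k m J c : k <= m -> L k J -> len J * `|a J - c| <= osum m J c.
Proof.
move=> km LJ; apply: le_trans (ler_norm_wsum (partseq_len_gt0 km LJ) _).
under eq_bigr do rewrite mulrBr.
rewrite sumrB (wsum_average km LJ (gen_integrable LJ)) -mulr_suml -(len_sum km
  LJ).
by rewrite -mulrBr normrM (gtr0_norm (len_gt0 LJ)).
Qed.

Lemma vsum_self k J c : L k J -> vsum k J c = len J * (a J - c) ^+ 2.
Proof. by move=> LJ; rewrite /vsum (partseq_self LJ) big_seq1. Qed.

Lemma part_has_parent k I J : L k I -> has_parent L I -> parts L (k + 1) I J ->
  has_parent L J.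
Proof.
move=> LI pI PJ; have [->//|JI] := EM (J = I).
by exists I; [exists k|exact: parts_child LI PJ JI].
Qed.

Variables (M D : R).
Hypotheses (M_gt0 : 0 < M) (D_ge0 : 0 <= D).
Hypothesis osumB : forall k m J, k <= m -> L k J -> has_parent L J ->
  osum m J (a J) <= 2 * M * len J.
Hypothesis jumpB : forall I J,
  intervals L I -> has_parent L I -> children L I J ->
  `|a J - a I| <= D.

(** [lam] is twice the bound 2 M of the mean oscillation, and [bmoC] is the solution of c = (lam +
    D)^2 + c / 2. *)
Let lam : R := 4 * M.
Let bmoC : R := 2 * (lam + D) ^+ 2.

(* Stop at the first interval [I] with [|a I - a J| > lam]: up to that time the
   martingale stays within [lam + D] of [a J], the stopped intervals cover at
   most half of [J], and the induction hypothesis applies in each of them. *)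
Lemma john_nirenberg (n : nat) k J : L k J -> has_parent L J ->
  vsum (k + n) J (a J) <= bmoC * len J.
Proof.
have lam0 : 0 < lam by rewrite mulr_gt0.
have bmoC_ge0 : 0 <= bmoC by rewrite mulr_ge0// sqr_ge0.
elim/ltn_ind: n k J => n IH k J LJ pJ.
set c := a J.
(* The inner induction descends through unstopped intervals; in a stopped one the outer hypothesis
   takes over, with fewer generations left. The [osum] term pays for the stopped intervals. *)
suff inner (e : nat) : (e <= n)%N -> forall j I, L j I -> has_parent L I ->
    `|a I - c| <= lam ->
    vsum (j + e) I c <= (lam + D) ^+ 2 * len I + bmoC / lam * osum (j + e) I c.
  have kn : k <= k + n%:Z by rewrite lerDl.
  have h0 : `|a J - c| <= lam by rewrite subrr normr0 ltW.
  have := inner n (leqnn _) k J LJ pJ h0; have := osumB kn LJ pJ;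
    rewrite -/c => h1 h2.
  apply: (le_trans h2).
  apply: (@le_trans _ _ ((lam + D) ^+ 2 * len J + bmoC / lam * (2 * M * len
    J))).
    by rewrite lerD2l ler_wpM2l// divr_ge0// ltW.
  rewrite le_eqVlt; apply/orP; left; apply/eqP.
  by rewrite /bmoC /lam; field; rewrite gt_eqF.
elim: e => [_|e IHe en] j I LI pI aI.
  rewrite addr0 (vsum_self _ LI); apply: ler_wpDr.
    rewrite mulr_ge0//; first by rewrite divr_ge0// ltW.
    by apply: (wsum_ge0 (partseq_len_gt0 (lexx j) LI)) => *.
  rewrite [leLHS]mulrC ler_wpM2r ?(ltW (len_gt0 LI))//.
  rewrite -real_normK ?num_real// ler_sqr ?nnegrE//;
    last by rewrite addr_ge0// ltW.
  by apply: (le_trans aI); rewrite lerDl.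
have je : j + e.+1%:Z = j + 1 + e%:Z by rewrite -addn1 PoszD [e%:Z + _]addrC
  addrA.
have j1 : j + 1 <= j + e.+1%:Z by rewrite je lerDl.
rewrite (vsum_rec _ j1 LI) (osum_rec _ j1 LI) (len_sum (le_addz1 j) LI).
rewrite !mulr_sumr -big_split/= big_seq [leRHS]big_seq.
apply: ler_sum => C /(partseqP _ (le_addz1 j) LI) PC; have [LC CI] := PC.
have pC := part_has_parent LI pI PC; rewrite je.
have [small|big] := leP `|a C - c| lam.
  by apply: IHe => //; exact: ltnW.
have j2 : j + 1 <= j + 1 + e%:Z by rewrite lerDl.
(* The stopping value exceeds [lam] by at most one jump from the unstopped [I]. *)
have aC : `|a C - c| <= lam + D.
  have -> : a C - c = (a I - c) + (a C - a I) by ring.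
  apply: (le_trans (ler_normD _ _)); apply: lerD => //.
  have [->|CnI] := EM (C = I); first by rewrite subrr normr0.
  by apply: jumpB => //; [exists j|exact: parts_child LI PC CnI].
rewrite (vsum_shift _ j2 LC) addrC; apply: lerD; last first.
  rewrite [leLHS]mulrC ler_wpM2r ?(ltW (len_gt0 LC))//.
  by rewrite -real_normK ?num_real// ler_sqr ?nnegrE// addr_ge0// ltW.
(* By [osum_ge], a stopped [C] has lam |C| <= osum, so bmoC |C| is covered by its share of the
   [osum] term. *)
apply: (le_trans (IH _ en _ _ LC pC)).
rewrite -mulrA ler_wpM2l// ler_pdivlMl//.
apply: le_trans (osum_ge _ j2 LC).
by rewrite mulrC ler_wpM2l// ltW// (len_gt0 LC).
Qed.

Local Notation x := (jump L (btilde0 L b)).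

Lemma gen_A0fin k J : L k J -> ~ has_parent L J -> A0fin L J.
Proof.
by move=> LJ npJ; split; [exact: no_parent_A0 LJ npJ|rewrite (mu_gen LJ) ltry].
Qed.

Lemma jumpE I J : children L I J -> x J = if `[< A0fin L I >] then 0 else a J -
  a I.
Proof.
move=> cJ; have [k [rI PJ]] := child_rank cJ.
have [y Jy] := gen_neq0 (proj1 PJ).
have val z : J z -> btilde0 L b I z = if `[< A0fin L I >] then 0 else a J - a I.
  move=> Jz; rewrite /btilde0; case: ifP => // _.
  exact: (proj2 (Delta_step b rI)).
rewrite /jump; case: xgetP => [c _ [I' [_ cJ' h]]|/(_ (if `[< A0fin L I >] then
  0 else a J - a I))].
  by rewrite -(val y Jy) (parent_uniq cJ cJ') h.
case; exists I; split => //.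
by exists k; exact: (proj1 rI).
Qed.

Lemma jump_no_parent J : ~ has_parent L J -> x J = 0.
Proof.
move=> npJ; rewrite /jump; case: xgetP => // c _ [I [iI cJ _]].
by exfalso; apply: npJ; exists I.
Qed.

Lemma jump_le J : `|x J| <= D.
Proof.
have [[I iI cJ]|npJ] := EM (has_parent L J);
  last by rewrite jump_no_parent// normr0.
rewrite (jumpE cJ); case: asboolP => [_|nA]; first by rewrite normr0.
apply: jumpB => //; have [//|npI] := EM (has_parent L I).
by have [k LI] := iI; exfalso; apply: nA; exact: gen_A0fin LI npI.
Qed.

Section FiniteFamily.
Variable F : seq (set R).
Hypothesis uF : uniq F.

Let phi I := x I ^+ 2 * len I.
Let inside J I := `[< I `<=` J >] && (I != J).
(** Strict subintervals only: the jump at [J] compares [J] with its parent and is invisible to the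
    variance inside [J]. *)
Let S J := \sum_(I <- F | inside J I) phi I.

Let phi_ge0 I : 0 <= phi I.
Proof. by rewrite mulr_ge0 ?sqr_ge0// fine_ge0. Qed.

Let S_sub J : \sum_(I <- F | `[< I `<=` J >]) phi I <= phi J + S J.
Proof.
rewrite (bigID (fun I => I == J))/=; apply: lerD => //.
apply: (@le_trans _ _ (\sum_(I <- F | I == J) phi I)).
  rewrite big_mkcond [leRHS]big_mkcond/=; apply: ler_sum => I _.
  by case: (I == J); rewrite ?andbF// andbT; case: ifP.
have [FJ|nFJ] := boolP (J \in F).
  by rewrite big_mkcond (bigD1_seq J)//= eqxx big1 ?addr0// => I /negbTE ->.
rewrite big1_seq// => I /andP[/eqP -> FJ].
by rewrite FJ in nFJ.
Qed.

(** If [J] survives into generation k + 1, the only cell is [J], whose own jump is not part of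
    [S J]; hence the case distinction. *)
Let S_split k J : L k J -> (forall I, I \in F -> intervals L I) ->
  S J <= \sum_(C <- partseq L (k + 1) J) ((if C == J then 0 else phi C) + S C).
Proof.
move=> LJ iF; have kk := le_addz1 k.
apply: (@le_trans _ _ (\sum_(I <- F) \sum_(C <- partseq L (k + 1) J)
    if inside J I && `[< I `<=` C >] then phi I else 0)).
  rewrite /S big_mkcond/= big_seq [leRHS]big_seq; apply: ler_sum => I FI.
  have [II|_] := boolP (inside J I); last first.
    by apply: sumr_ge0 => C _; rewrite /=.
  have /andP[/asboolP IJ /eqP nIJ] := II.
  have [m LI] := iF _ FI; have [y Iy] := gen_neq0 LI.
  have [C PC Cy] := parts_cover kk LJ (IJ _ Iy); have [LC CJ] := PC.
  have km : k + 1 <= m by rewrite lezD1; exact: (sub_child_level LJ LI IJ nIJ).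
  rewrite (bigD1_seq C) ?partseq_uniq//=; last exact/(partseqP _ kk LJ).
  rewrite asboolT; last exact: (gen_nested km LC LI Cy Iy).
  by rewrite lerDl; apply: sumr_ge0 => C1 _; case: asbool.
rewrite exchange_big/= big_seq [leRHS]big_seq; apply: ler_sum => C _.
rewrite -big_mkcond/=; have [->|CJ] := eqVneq C J.
  rewrite add0r le_eqVlt; apply/orP; left; apply/eqP; apply: eq_bigl => I.
  by rewrite /inside andbAC andbb.
apply: le_trans (S_sub C); rewrite big_mkcond [leRHS]big_mkcond/=.
by apply: ler_sum => I _; case: (inside J I) => //=; case: ifP.
Qed.

Let S_level0 k J : L k J -> (forall I, I \in F -> exists2 j, j <= k & L j I) ->
  S J = 0.
Proof.
move=> LJ lF; rewrite /S big1_seq// => I /andP[/andP[/asboolP IJ /eqP nIJ] FI].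
have [j jk LI] := lF _ FI.
by have := sub_child_level LJ LI IJ nIJ; rewrite ltNge jk.
Qed.

(** One generation at a time, [vsum_shift] splits off len C (a C - a J)^2, which dominates the jump
    term of the child [C]. *)
Let S_vsum (n : nat) k J : L k J -> has_parent L J ->
  (forall I, I \in F -> exists2 j,
    j <= k + n%:Z & L j I) -> S J <= vsum (k + n) J (a J).
Proof.
elim: n k J => [|n IH] k J LJ pJ lF.
  by rewrite addr0 in lF *; rewrite (S_level0 LJ lF) (vsum_ge0 _ (lexx k) LJ).
have kn : k + n.+1%:Z = k + 1 + n%:Z by rewrite -addn1 PoszD [n%:Z + _]addrC
  addrA.
have iF I : I \in F -> intervals L I by move=> /lF[j _ LI]; exists j.
rewrite kn in lF *; have k1 : k + 1 <= k + 1 + n%:Z by rewrite lerDl.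
apply: (le_trans (S_split LJ iF)).
rewrite (vsum_rec _ k1 LJ) big_seq [leRHS]big_seq; apply: ler_sum => C.
move=> /(partseqP _ (le_addz1 k) LJ) PC; have [LC CJ] := PC.
rewrite (vsum_shift _ k1 LC) addrC; apply: lerD.
  by apply: IH lF => //; exact: part_has_parent LJ pJ PC.
case: eqP => [->|nCJ]; first by rewrite subrr expr0n mulr0.
have cC := parts_child LJ PC nCJ.
rewrite /phi (jumpE cC); case: asboolP => [_|_].
  by rewrite expr0n mul0r mulr_ge0 ?sqr_ge0// ltW// (len_gt0 LC).
by rewrite mulrC.
Qed.

(** A parentless [J] has no oscillation bound. Either it survives into the next generation, or its
    children have zero jump, [J] being in [A0fin], and have a parent, so that [parentS] applies to
    each. *)
Let S_le (n : nat) k J : L k J ->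
  (forall I, I \in F -> exists2 j,
    j <= k + n%:Z & L j I) -> S J <= bmoC * len J.
Proof.
have bmoC_ge0 : 0 <= bmoC by rewrite mulr_ge0// sqr_ge0.
have parentS n' k' J' : L k' J' -> has_parent L J' ->
    (forall I, I \in F -> exists2 j,
      j <= k' + n'%:Z & L j I) -> S J' <= bmoC * len J'.
  by move=> LJ' pJ' lF;
    apply: le_trans (S_vsum LJ' pJ' lF) (john_nirenberg _ LJ' pJ').
elim: n k J => [|n IH] k J LJ lF.
  by rewrite addr0 in lF;
    rewrite (S_level0 LJ lF) mulr_ge0// ltW// (len_gt0 LJ).
have [pJ|npJ] := EM (has_parent L J); first exact: parentS lF.
have kn : k + n.+1%:Z = k + 1 + n%:Z by rewrite -addn1 PoszD [n%:Z + _]addrC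
  addrA.
have iF I : I \in F -> intervals L I by move=> /lF[j _ LI]; exists j.
rewrite kn in lF; apply: (le_trans (S_split LJ iF)).
rewrite (len_sum (le_addz1 k) LJ) mulr_sumr big_seq [leRHS]big_seq;
  apply: ler_sum => C.
move=> /(partseqP _ (le_addz1 k) LJ) PC; have [LC CJ] := PC.
case: eqP => [CJ'|nCJ]; first by rewrite add0r; exact: IH lF.
have cC := parts_child LJ PC nCJ.
rewrite /phi (jumpE cC) asboolT; last exact: gen_A0fin LJ npJ.
rewrite expr0n mul0r add0r; apply: parentS lF => //.
by exists J => //; exists k.
Qed.

(** The term D^2 accounts for the jump at [J] itself. Finiteness of [F] bounds the generations to be
    considered. *)
Lemma carleson_sum J : intervals L J ->
  (forall I, I \in F -> intervals L I /\ I `<=` J) ->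
  \sum_(I <- F) `|x I| ^+ 2 * len I <= (D ^+ 2 + bmoC) * len J.
Proof.
move=> [k LJ] FJ.
have [n lF] : exists n : nat, forall I, I \in F -> exists2 j,
  j <= k + n%:Z & L j I.
  have iF I : I \in F -> intervals L I by move=> /FJ[].
  elim: F iF => [|I G IH] iF; first by exists 0%N.
  have [|n lG] := IH; first by move=> C GC; apply: iF; rewrite in_cons GC orbT.
  have [j LI] := iF _ (mem_head _ _).
  exists (n + `|j - k|)%N => C; rewrite in_cons => /predU1P[->|/lG[j' j'n LC]].
    exists j => //; rewrite -lerBlDl; apply: (@le_trans _ _ `|j - k|%N%:Z).
      by rewrite abszE ler_norm.
    by rewrite PoszD lerDr.
  by exists j' => //; apply: (le_trans j'n); rewrite lerD2l lez_nat leq_addr.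
rewrite mulrDl (eq_bigr phi); last by move=> I _; rewrite real_normK ?num_real.
rewrite (eq_big_seq (fun I => if `[< I `<=` J >] then phi I else 0));
  last first.
  by move=> I /FJ[_ IJ]; rewrite asboolT.
rewrite -big_mkcond; apply: (le_trans (S_sub J)); apply: lerD.
  rewrite ler_wpM2r// ?(ltW (len_gt0 LJ))//.
  by rewrite -real_normK ?num_real// ler_sqr ?nnegrE// jump_le.
exact: S_le lF.
Qed.
End FiniteFamily.

Lemma bmo_norm_le :
  (bmo_norm L (btilde0 L b) <= ((D ^+ 2 + bmoC) `^ 2^-1)%:E)%E.
Proof.
have bmoC_ge0 : 0 <= bmoC by rewrite mulr_ge0// sqr_ge0.
apply: ge_ereal_sup => _ [J iJ <-]; have [k LJ] := iJ.
have l0 := len_gt0 LJ.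
apply: (@le_trans _ _ (((D ^+ 2 + bmoC)%:E `^ 2^-1)%E));
  last by rewrite poweR_EFin.
have e0 : (0 <= \esum_(I in [set I | intervals L I /\ I `<=` J])
         (`|x I| ^+ 2 * len I)%R%:E)%E.
  by apply: esum_ge0 => I _; rewrite lee_fin mulr_ge0// fine_ge0.
apply: gt0_ler_poweR; rewrite ?invr_ge0// ?in_itv/= ?leey ?andbT.
- by rewrite mule_ge0// lee_fin invr_ge0 ltW.
- by rewrite lee_fin addr_ge0// sqr_ge0.
rewrite lee_pdivrMl//; apply: ge_ereal_sup => _ [F [fF FJ] <-].
rewrite fsbig_finite// sumEFin -EFinM lee_fin mulrC.
apply: carleson_sum => //; first exact: finmap.fset_uniq.
by move=> I; rewrite in_fset_set// => /set_mem/FJ.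
Qed.
End JohnNirenberg.

(** * Testing the commutator on one non-degenerate child *)

Section CommutatorTests.
Variables (R : realType) (X : set R) (L : lattice X) (b : R -> R).
Hypotheses (mX : measurable X) (ib : loc_integrable L b).
Implicit Types (A C I J : set R) (j k m : int) (G H : set R -> R).
Implicit Types (f g h d : R -> R) (S T : blocks R).
Local Notation mu := (@lebesgue_measure R).
Local Notation len := (@len R).
Local Notation a := (average b).
Local Notation ch k I := (partseq L (k + 1) I).

Definition bounded_blocks S (p B : R) : Prop := forall I h,
  intervals L I -> DI L I h -> (norm_p p%:E (S I h) <= B%:E * norm_p p%:E h)%E.

Definition adjoint_pair S T : Prop := forall I h g, intervals L I ->
  DI L I h -> DI L I g -> pairing X (S I h) g = pairing X h (T I g).

Definition commutator_bound S T (p q N : R) : Prop := forall f g,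
  finite_sum L f -> finite_sum L g ->
  (`|pairing X (fun x => b x * apply_mt L S f x) g -
     pairing X (fun x => b x * f x) (apply_mt L T g)|%:E <=
   N%:E * norm_p p%:E f * norm_p q%:E g)%E.

(* [T] and its adjoint exchange their roles in the weakly mixing case. *)
Record comm_pair S T (p q N B : R) : Prop := CommPair {
  cp_left : block_op L S;
  cp_right : block_op L T;
  cp_adjoint : adjoint_pair S T;
  cp_bound_left : bounded_blocks S p B;
  cp_bound_right : bounded_blocks T q B;
  cp_comm : commutator_bound S T p q N }.

Lemma norm_p_ge0 (p : \bar R) f : (0 <= norm_p p f)%E.
Proof. exact: Lnorm_ge0. Qed.

Lemma norm_dstep k I h G p : 0 < p -> is_rank L I k -> dstep L k I h G ->
  norm_p p%:E h = (wnorm (ch k I) len p G)%:E.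
Proof. by move=> p0 rI [st _]; exact: norm_step p0 (le_addz1 k) (proj1 rI) st.
  Qed.

Lemma mt_bounded_blocks T p : martingale_transform L T -> 1 < p ->
  (blocks_norm L p T < +oo)%E -> bounded_blocks T p (fine (blocks_norm L p T)).
Proof.
move=> mT p1 Tfin I h iI hI; have p0 : 0 < p by rewrite (lt_trans _ p1).
have [T1 T2] := mT _ iI; have [_ T0] := mt_block_op mT iI.
have [[k rI]|nr] := EM (exists k, is_rank L I k); last first.
  rewrite (DI_unranked nr hI) T0 (_ : norm_p p%:E (fun=> 0) = 0%E) ?mule0//.
  by rewrite /norm_p (_ : EFin \o _ = cst 0%E)// Lnorm0// gt_eqF.
have small d : DI L I d -> (norm_p p%:E d <= 1)%E ->
    (norm_p p%:E (T I d) <= (fine (blocks_norm L p T))%:E)%E.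
  move=> dI d1.
  have le : (norm_p p%:E (T I d) <= blocks_norm L p T)%E.
    apply: (@le_trans _ _ (block_norm L p T I)); apply: ereal_sup_ubound;
      last by exists I.
    by exists d.
  by rewrite fineK// ge0_fin_numE// (le_trans _ le)// norm_p_ge0.
have l0 := partseq_len_gt0 (le_addz1 k) (proj1 rI).
have [G hG] := DI_dstep mX rI hI; have [H tH] := DI_dstep mX rI (T1 _ hI).
rewrite (norm_dstep p0 rI hG) (norm_dstep p0 rI tH) -EFinM lee_fin.
set w := wnorm _ _ _ G; have w0 : 0 <= w by exact: wnorm_ge0.
have [w00|wn0] := eqVneq w 0.
  have h0 : h = fun=> 0.
    apply: (is_step_eq (le_addz1 k) (proj1 rI) (proj1 hG));
      split => // J x PJ _.
    apply/esym; apply: (wsum_powR_eq0 l0 p0);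
      last exact/(partseqP _ (le_addz1 k) (proj1 rI)).
    by rewrite -(wnorm_powR l0)// -/w w00 powR0// gt_eqF.
  have := norm_dstep p0 rI tH; rewrite h0 T0 (_ : norm_p p%:E (fun=> 0) = 0%E).
    by rewrite w00 mulr0 => -[<-].
  by rewrite /norm_p (_ : EFin \o _ = cst 0%E)// Lnorm0// gt_eqF.
have {}w0 : 0 < w by rewrite lt0r wn0.
have d0 : dstep L k I (fun=> 0) (fun=> 0).
  by split=> //; rewrite big1// => J _; rewrite mulr0.
have sG := dstep_lin w^-1 hG d0.
have := small _ (dstep_DI rI sG); rewrite (norm_dstep p0 rI sG).
rewrite (@eq_wnorm _ _ _ _ _ _ (fun J => w^-1 * G J)); last by move=> J _;
  rewrite addr0.
rewrite (wnormZ l0)// -/w gtr0_norm ?invr_gt0// mulVf// lexx => /(_ isT).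
rewrite T2//; last exact: DI0.
rewrite T0 (norm_dstep p0 rI (dstep_lin w^-1 tH d0)).
rewrite (@eq_wnorm _ _ _ _ _ _ (fun J => w^-1 * H J)); last by move=> J _;
  rewrite addr0.
by rewrite (wnormZ l0)// gtr0_norm ?invr_gt0// lee_fin mulrC ler_pdivrMr.
Qed.

Lemma bounded_blocks_le S p B B' : B <= B' -> bounded_blocks S p B ->
  bounded_blocks S p B'.
Proof.
move=> BB' SB I h iI hI; apply: (le_trans (SB I h iI hI)).
by rewrite lee_wpmul2r ?norm_p_ge0// lee_fin.
Qed.

(** The pairing <f, T_I^* g> = <T_I f, g> is controlled for mean-zero [f] only; the 4 is the
    constant of [wnorm_dual]. *)
Lemma adjoint_bounded_blocks T p q B : martingale_transform L T ->
  1 < p -> 1 < q -> p^-1 + q^-1 = 1 -> 0 <= B ->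
  bounded_blocks T p B -> bounded_blocks (adjoint L T) q (4 * B).
Proof.
move=> mT p1 q1 pq B0 TB I g iI gI.
have p0 : 0 < p by rewrite (lt_trans _ p1).
have q0 : 0 < q by rewrite (lt_trans _ q1).
have [aI aP] := adjointP mX mT iI gI.
have [T1 _] := mT _ iI; have [_ a0] := adjoint_block_op mX mT iI.
have [[k rI]|nr] := EM (exists k, is_rank L I k); last first.
  rewrite (DI_unranked nr gI) a0 (_ : norm_p q%:E (fun=> 0) = 0%E) ?mule0//.
  by rewrite /norm_p (_ : EFin \o _ = cst 0%E)// Lnorm0// gt_eqF.
have LI := proj1 rI; have kk := le_addz1 k.
have l0 := partseq_len_gt0 kk LI.
have [G gG] := DI_dstep mX rI gI; have [H aH] := DI_dstep mX rI aI.
rewrite (norm_dstep q0 rI gG) (norm_dstep q0 rI aH) -EFinM lee_fin -mulrA.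
apply: (wnorm_dual l0 (partseq_neq0 kk LI) p1 q1 pq); last 1 first.
- move=> F F0; have dF : dstep L k I (stepf L (k + 1) I F) F.
    by split=> //; exact: is_step_stepf kk LI.
  have FI := dstep_DI rI dF.
  have [E tE] := DI_dstep mX rI (T1 _ FI).
  rewrite -(pairing_dstep LI dF aH) -aP// (pairing_dstep LI tE gG).
  apply: (le_trans (ler_norm_wsum l0 _)).
  under eq_bigr do rewrite normrM.
  apply: (le_trans (hoelder_wsum l0 _ _ p1 q1 pq)).
  have := TB I _ iI FI;
    rewrite (norm_dstep p0 rI dF) (norm_dstep p0 rI tE) -EFinM lee_fin => le.
  by rewrite mulrAC; apply: ler_wpM2r => //; exact: wnorm_ge0.
- by rewrite mulr_ge0// wnorm_ge0.
- exact: (proj2 aH).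
Qed.

Section Generic.
Variables (S T : blocks R) (p q N B eps K : R).
Hypotheses (p1 : 1 < p) (q1 : 1 < q) (pq : p^-1 + q^-1 = 1).
Hypotheses (N0 : 0 <= N) (B0 : 0 < B) (eps0 : 0 < eps) (K0 : 0 < K).
Hypothesis ST : comm_pair S T p q N B.

Let p0 : 0 < p. Proof. by rewrite (lt_trans _ p1). Qed.
Let q0 : 0 < q. Proof. by rewrite (lt_trans _ q1). Qed.
Let M := N / eps.
Let M0 : 0 <= M. Proof. by rewrite divr_ge0// ltW. Qed.

(** A dual form of an L^p bound of order M |J|^(1/p) for E_m b - a J on [J], at every generation m;
    it tests only the mean-zero functions that the commutator admits. *)
Definition oscillation J : Prop := forall k m G, L k J -> k <= m ->
  \sum_(I <- partseq L m J) len I * G I = 0 ->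
  `|\sum_(I <- partseq L m J) len I * (a I * G I)| <=
    M * len J `^ p^-1 * wnorm (partseq L m J) len q G.

Lemma nondegenerate_value k I J h H : is_rank L I k -> parts L (k + 1) I J ->
  dstep L k I (S I h) H ->
  (eps%:E <= norm_p p%:E (fun x => (\1_J x * S I h x)%R))%E ->
  eps <= `|H J| * len J `^ p^-1.
Proof.
move=> rI PJ [[_ s1] _].
have st : is_step L (k + 1) J (fun x => (\1_J x * S I h x)%R) (fun=> H J).
  split=> [x nJx|C x]; first by rewrite indicE memNset// mul0r.
  rewrite (parts_self (proj1 PJ)) => -> Jx.
  by rewrite indicE mem_set// mul1r (s1 J).
rewrite (norm_step p0 (lexx _) (proj1 PJ) st) lee_fin => /le_trans; apply.
rewrite wnorm_cst//; first by rewrite (partseq_self (proj1 PJ)) big_seq1.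
exact: (partseq_len_gt0 (lexx _) (proj1 PJ)).
Qed.

Lemma nondegenerate_oscillation I J : intervals L I -> children L I J ->
  nondegenerate_at L p eps K S I J -> oscillation J.
Proof.
move=> iI cJ [h [hI h1 hJ epsh _]] j m G LJ jm Gs.
have [k [rI PJ]] := child_rank cJ.
have [S1 _] := cp_left ST iI.
have [H sH] := DI_dstep mX rI (S1 _ hI).
have He := nondegenerate_value rI PJ sH epsh.
have st := is_step_stepf G jm LJ; set g := stepf _ _ _ _ in st.
have gJ := step_diff_sum mX jm LJ st Gs.
have fh := diff_sum_finite_sum (diff_sum_DI mX iI hI).
have fg := diff_sum_finite_sum gJ.
have := cp_comm ST fh fg; rewrite (apply_mt_DI mX (cp_left ST) iI hI) h1 mule1.
have -> : pairing X (fun x => b x * h x) (apply_mt L T g) = 0.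
  rewrite /pairing (_ : (fun x => _) = cst 0);
    first by rewrite Rintegral_cst ?mul0r.
  apply/funext => x; have [Jx|nJx] := EM (J x);
    first by rewrite hJ// mulr0 mul0r.
  by rewrite (apply_mt_out mX (cp_right ST) gJ nJx) mulr0.
have -> : pairing X (fun x => b x * S I h x) g =
    \sum_(I <- partseq L m J) len I * (a I * (H J * G I)).
  (* [S I h] lives on all of [I], but [g] vanishes off [J]; the cut-off makes it a one-valued step
     function on the pieces of [g]. *)
  have stJ : is_step L m J (fun x => S I h x * \1_J x) (fun=> H J).
    split=> [x nJx|C x [_ CJ] Cx]; first by rewrite indicE memNset// mulr0.
    by rewrite indicE mem_set ?mulr1;
      [exact: (proj2 (proj1 sH)) PJ (CJ _ Cx)|exact: CJ].
  rewrite -(pairing_step jm LJ stJ st); last by move=> C [LC _];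
    exact: gen_integrable LC.
  apply: eq_Rintegral => x _; have [Jx|nJx] := EM (J x);
    last by rewrite (proj1 st)// !mulr0.
  by rewrite indicE mem_set// mulr1.
rewrite subr0 (norm_step q0 jm LJ st) -EFinM lee_fin.
have -> : \sum_(I <- partseq L m J) len I * (a I * (H J * G I)) =
    H J * \sum_(I <- partseq L m J) len I * (a I * G I).
  by rewrite mulr_sumr; apply: eq_bigr => C _; ring.
rewrite normrM; set P := `|\sum_(I <- _) _|; set W := wnorm _ _ _ _ => le.
have P0 : 0 <= P by exact: normr_ge0.
have lJ0 : 0 < len J `^ p^-1 by rewrite powR_gt0// (len_gt0 LJ).
have le2 : eps * P <= N * W * len J `^ p^-1.
  apply: (@le_trans _ _ (`|H J| * len J `^ p^-1 * P)); first exact: ler_wpM2r.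
  by rewrite mulrAC ler_pM2r.
rewrite /M [leRHS](_ : _ = N * W * len J `^ p^-1 / eps); last by ring.
by rewrite ler_pdivlMr// mulrC.
Qed.

(** The test function is the centered sign of a I - a J. It is bounded by 2, so its L^q norm is at
    most 2 |J|^(1/q), and the two powers of |J| multiply to |J|. *)
Lemma oscillation_osum k m J : k <= m -> L k J -> oscillation J ->
  osum L b m J (a J) <= 2 * M * len J.
Proof.
move=> km LJ osc; have l0 := partseq_len_gt0 km LJ.
have s0 := partseq_neq0 km LJ.
set s := partseq L m J in l0 s0.
have tot := len_sum km LJ; rewrite -/s in tot.
have lJ0 := len_gt0 LJ.
pose sg I := Num.sg (a I - a J).
have beta0 : \sum_(I <- s) len I * (a I - a J) = 0.
  exact: wsum_average_sub km LJ (gen_integrable ib LJ).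
have cs0 := wsum_center l0 s0 sg.
have := osc k m (center s len sg) LJ km cs0; rewrite -/s.
have -> : \sum_(I <- s) len I * (a I * center s len sg I) = osum L b m J (a J).
  transitivity (\sum_(I <- s) len I * ((a I - a J) * center s len sg I)).
    rewrite (eq_bigr (fun I => len I * ((a I - a J) * center s len sg I) +
                               a J * (len I * center s len sg I))); last first.
      by move=> I _; ring.
    by rewrite big_split/= -mulr_sumr cs0 mulr0 addr0.
  rewrite (wsum_mul_center _ beta0); apply: eq_bigr => I _.
  by rewrite /sg [_ * Num.sg _]mulrC -normrEsg.
rewrite ger0_norm; last by apply: (wsum_ge0 l0).
move/le_trans; apply.
have c2 : wnorm s len q (center s len sg) <= 2 * len J `^ q^-1.
  have -> : 2 * len J `^ q^-1 = wnorm s len q (fun=> 2).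
    by rewrite (wnorm_cst l0)// ger0_norm// tot.
  apply: (wnorm_le l0 q0); first exact: wnorm_ge0.
  rewrite (wnorm_powR l0)//; apply: (wsum_le l0) => I _.
  apply: ge0_ler_powR; rewrite ?nnegrE ?(ltW q0)// /center -tot.
  have sg1 C : `|sg C| <= 1 by rewrite normr_sg lern1 leq_b1.
  apply: (le_trans (ler_normB _ _));
    rewrite [`|2|]ger0_norm// (_ : (2 : R) = 1 + 1)//.
  apply: lerD => //; rewrite normrM normfV (gtr0_norm lJ0) ler_pdivrMr// mul1r.
  apply: (le_trans (ler_norm_wsum l0 _)); rewrite tot -/s.
  rewrite [leRHS](_ : _ = \sum_(C <- s) len C * 1); first exact: wsum_le.
  by apply: eq_bigr => C _; rewrite mulr1.
apply: (@le_trans _ _ (M * len J `^ p^-1 * (2 * len J `^ q^-1))).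
  by rewrite ler_wpM2l// mulr_ge0// powR_ge0.
rewrite [leLHS](_ : _ = 2 * M * (len J `^ p^-1 * len J `^ q^-1)); last by ring.
rewrite -powRD; last by rewrite (gt_eqF lJ0) implybT.
by rewrite pq powRr1// ltW.
Qed.

(** Each piece has positive length, so an essential bound holds on it. *)
Lemma norm_infty_step k m I h G (r : R) : k <= m -> L k I -> is_step L m I h G
  ->
  (norm_p +oo%E h <= r%:E)%E -> forall J, parts L m I J -> `|G J| <= r.
Proof.
move=> km LI st + J PJ; rewrite /norm_p unlock.
have LJ := proj1 PJ.
have muJ : (0 < mu J)%E by rewrite (mu_gen LJ) lte_fin (len_gt0 LJ).
rewrite ifT; last first.
  by apply: (lt_le_trans muJ); apply: le_measure; rewrite ?inE//;
    exact: gen_measurable LJ.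
move=> /ess_supP[A [mA A0 sA]]; rewrite leNgt; apply/negP => rG.
suff : (mu J <= 0)%E by rewrite leNgt muJ.
rewrite -A0; apply: le_measure; rewrite ?inE//; first exact: gen_measurable LJ.
move=> x Jx; apply: sA => /=; rewrite (proj2 st J x PJ Jx) lee_fin.
by rewrite leNgt rG.
Qed.

Definition jump_const : R :=
  4 * M * (K + 2) + (2 * N + 8 * M * K * B + 8 * M * B) / eps.

Lemma nondegenerate_jump I J : intervals L I -> children L I J -> oscillation I
  ->
  nondegenerate_at L p eps K S I J -> `|a J - a I| <= jump_const.
Proof.
move=> iI cJ osc [h [hI h1 hJ epsh hK]].
have [k [rI PJ]] := child_rank cJ; have LI := proj1 rI; have kk := le_addz1 k.
have [S1 _] := cp_left ST iI; have [T1 _] := cp_right ST iI.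
have [H sH] := DI_dstep mX rI (S1 _ hI).
have [E hE] := DI_dstep mX rI hI.
have He := nondegenerate_value rI PJ sH epsh.
have l0 := partseq_len_gt0 kk LI.
set s := ch k I in l0.
have tot := len_sum kk LI; rewrite -/s in tot.
have beta0 : \sum_(J <- s) len J * (a J - a I) = 0.
  exact: wsum_average_sub kk LI (gen_integrable ib LI).
have toa (G F : set R -> R) : \sum_(J <- s) len J * G J = 0 ->
    \sum_(J <- s) len J * ((a J - a I) * G J) = \sum_(J <- s) len J * (a J * G
      J).
  move=> G0; rewrite [RHS](eq_bigr (fun J => len J * ((a J - a I) * G J) + a I
    * (len J * G J))).
    by rewrite big_split/= -mulr_sumr G0 mulr0 addr0.
  by move=> C _; ring.
apply: (@jump_bound R _ s len p q M N B K eps (fun J => a J - a I) E H J) => //.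
- exact: partseq_uniq.
- exact/(partseqP _ kk LI).
- move=> G G0; rewrite toa// -tot.
  exact: (osc k (k + 1) G LI kk G0).
- by rewrite -tot; exact: oscillation_osum kk LI osc.
- move=> G G0.
  have gG : dstep L k I (stepf L (k + 1) I G) G by split=> //;
    exact: is_step_stepf kk LI.
  set g := stepf _ _ _ _ in gG; have gI := dstep_DI rI gG.
  have [F tF] := DI_dstep mX rI (T1 _ gI).
  exists F.
    have := cp_bound_right ST iI gI.
    by rewrite (norm_dstep q0 rI gG) (norm_dstep q0 rI tF) -EFinM lee_fin.
  have := cp_comm ST (diff_sum_finite_sum (diff_sum_DI mX iI hI))
                     (diff_sum_finite_sum (diff_sum_DI mX iI gI)).
  rewrite (apply_mt_DI mX (cp_left ST) iI hI) (apply_mt_DI mX (cp_right ST) iI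
    gI).
  have ibC C : parts L (k + 1) I C -> mu.-integrable C (EFin \o b).
    by move=> [LC _]; exact: gen_integrable LC.
  rewrite (pairing_step kk LI (proj1 sH) (proj1 gG) ibC).
  rewrite (pairing_step kk LI (proj1 hE) (proj1 tF) ibC).
  rewrite h1 mule1 (norm_dstep q0 rI gG) -EFinM lee_fin -/s.
  (* Replacing b by b - a I changes the form by a I (<S h, g> - <h, T g>), which this identity makes
     zero. *)
  have adj := cp_adjoint ST iI hI gI.
  rewrite (pairing_dstep LI sH gG) (pairing_dstep LI hE tF) -/s in adj.
  rewrite -!sumrB.
  rewrite [X in `|X| <= _ -> _](_ : _ = \sum_(C <- s) (len C * ((a C - a I) *
    (H C * G C)) -
        len C * ((a C - a I) * (E C * F C)))) ?sumrB//.
  transitivity (\sum_(C <- s) (len C * ((a C - a I) * (H C * G C)) -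
        len C * ((a C - a I) * (E C * F C))) +
     a I * (\sum_(C <- s) len C * (H C * G C) - \sum_(C <- s) len C * (E C * F
       C))).
    by rewrite -!sumrB mulr_sumr -big_split/=; apply: eq_bigr => C _; ring.
  by rewrite sumrB adj subrr mulr0 addr0.
- have := cp_bound_left ST iI hI.
  by rewrite h1 mule1 (norm_dstep p0 rI sH) lee_fin.
- rewrite -tot => small C /(partseqP _ kk LI) PC.
  exact: (norm_infty_step kk LI (proj1 hE) (hK small) PC).
Qed.
End Generic.
End CommutatorTests.

(** * Constants and the two mixing hypotheses *)

Section Conclusion.
Variables (R : realType) (X : set R) (L : lattice X) (b : R -> R).
Hypotheses (mX : measurable X) (ib : loc_integrable L b).
Implicit Types (I J : set R) (f g : R -> R) (T : blocks R) (p q : R).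

(** Adding 1 avoids the question whether the infimum is attained. *)
Lemma comm_norm_bounded T p : (comm_norm L p b T < +oo)%E ->
  comm_bounded_by L p b T (`|fine (comm_norm L p b T)| + 1).
Proof.
move=> cfin; have c0 : (0 <= comm_norm L p b T)%E.
  by apply: le_ereal_inf_tmp => _ [N [N0 _] <-]; rewrite lee_fin.
have cE : comm_norm L p b T = (fine (comm_norm L p b T))%:E.
  by rewrite fineK// ge0_fin_numE.
have f0 : 0 <= fine (comm_norm L p b T) by rewrite fine_ge0.
split; first by rewrite addr_ge0.
have : (comm_norm L p b T < (`|fine (comm_norm L p b T)| + 1)%:E)%E.
  by rewrite {1}cE lte_fin ger0_norm// ltrDl.
move=> /ereal_inf_lt[_ [N [N0 bN] <-]]; rewrite lte_fin => NN f g ff fg.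
apply: (le_trans (bN f g ff fg)).
by rewrite lee_wpmul2r ?norm_p_ge0// lee_wpmul2r ?norm_p_ge0// lee_fin ltW.
Qed.

Lemma conj_expP p : 1 < p -> 1 < conj_exp p /\ p^-1 + (conj_exp p)^-1 = 1.
Proof.
move=> p1; have p0 : 0 < p by lra.
have pm : 0 < p - 1 by lra.
rewrite /conj_exp; split; first by rewrite ltr_pdivlMr//; lra.
by field; rewrite !gt_eqF.
Qed.

Lemma comm_pair_mt T p N B : martingale_transform L T -> 1 < p -> 0 <= B ->
  bounded_blocks L T p B -> comm_bounded_by L p b T N ->
  comm_pair L b T (adjoint L T) p (conj_exp p) N (4 * B).
Proof.
move=> mT p1 B0 TB [N0 bN]; have [q1 pq] := conj_expP p1.
have B4 : B <= 4 * B by rewrite ler_peMl// ler1n.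
split => //.
- exact: mt_block_op mT.
- exact: adjoint_block_op.
- by move=> I h g iI hI gI; apply: (proj2 (adjointP mX mT iI gI)).
- exact: bounded_blocks_le TB.
- exact: adjoint_bounded_blocks mT p1 q1 pq B0 TB.
Qed.

(** Exchanging [f] and [g] only changes the sign of the commutator form. *)
Lemma comm_pairC T T' p q N B : comm_pair L b T T' p q N B ->
  comm_pair L b T' T q p N B.
Proof.
case=> oT oT1 ad bT bT1 cm; split => //.
  by move=> I h g iI hI gI; rewrite pairingC -ad// pairingC.
move=> f g ff fg; have := cm g f fg ff.
rewrite distrC muleAC; congr (_ <= _)%E; congr (`| _ |%:E).
congr (_ - _); apply: eq_Rintegral => x _; ring.
Qed.

End Conclusion.

Unset Implicit Arguments.

Theorem theorem5p3 (R : realType) :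
  exists C : R -> R -> R -> R -> R -> R,
  forall (X : set R) (L : lattice X) (b : R -> R) (p eps K : R)
         (T : blocks R),
    is_interval X -> X !=set0 ->
    admissible L b -> loc_integrable L b ->
    1 < p -> 0 < eps -> 0 < K ->
    martingale_transform L T ->
    strongly_mixing L p eps K T \/ (p = 2 /\ weakly_mixing L 2 eps K T) ->
    (blocks_norm L p T < +oo)%E ->
    (comm_norm L p b T < +oo)%E ->
    in_bmo L (btilde0 L b) /\
    (bmo_norm L (btilde0 L b) <=
      (C p (fine (comm_norm L p b T)) (fine (blocks_norm L p T)) eps K)%:E)%E.
Proof.
(* The absolute values and added 1 keep the constants positive for all real arguments: [bmo_norm_le]
   needs M > 0 and [jump_bound] needs B > 0. The 4 in [B] covers the adjoint blocks. *)
pose N (n : R) := `|n| + 1.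
pose B (t : R) := 4 * (`|t| + 1).
pose M n eps := N n / eps.
pose D n t eps K := jump_const (N n) (B t) eps K.
exists (fun _ n t eps K =>
  (D n t eps K ^+ 2 + 2 * (4 * M n eps + D n t eps K) ^+ 2) `^ 2^-1).
move=> X L b p eps K T itvX _ _ ib p1 eps0 K0 mT mixing Tfin cfin.
have mX : measurable X by exact: is_interval_measurable.
set n := fine (comm_norm _ _ _ _); set t := fine (blocks_norm _ _ _).
have [q1 pq] := conj_expP p1; set q := conj_exp p in q1 pq.
have N0 : 0 < N n by rewrite ltr_wpDl.
have B0 : 0 < B t by rewrite mulr_gt0// ltr_wpDl.
have TB : bounded_blocks L T p (`|t| + 1).
  apply: bounded_blocks_le (mt_bounded_blocks mX mT p1 Tfin).
  by apply: (le_trans (ler_norm _)); rewrite lerDl.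
have cp : comm_pair L b T (adjoint L T) p q (N n) (B t).
  by apply: comm_pair_mt => //; exact: comm_norm_bounded.
have [osc jump] : (forall J,
  has_parent L J -> oscillation L b p q (N n) eps J) /\
    (forall I J, intervals L I -> children L I J -> oscillation L b p q (N n)
      eps I ->
       `|average b J - average b I| <= D n t eps K).
  have iJ I J : children L I J -> intervals L J.
    by move=> [k [_ LJ _]]; exists (k + 1).
  case: mixing => [mix|[p2 mix]].
    split=> [J [I iI cJ]|I J iI cJ oI].
      exact: (nondegenerate_oscillation mX ib p1 q1 eps0 cp iI cJ (mix _ _ iI
        (iJ _ _ cJ) cJ)).
    exact: (nondegenerate_jump mX ib p1 q1 pq (ltW N0) B0 eps0 K0 cp iI cJ oI
      (mix _ _ iI (iJ _ _ cJ) cJ)).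
  (* At exponent 2, [comm_pairC] gives the adjoint the same exponents and constants, so each child
     may use whichever non-degeneracy it has. *)
  subst p; have qE : conj_exp 2 = 2 :> R.
    by rewrite /conj_exp (_ : 2 - 1 = 1) ?divr1//; ring.
  have q2 : q = 2 by [].
  rewrite q2 in q1 pq cp *.
  have cp' := comm_pairC cp.
  split=> [J [I iI cJ]|I J iI cJ oI]; have := mix _ _ iI (iJ _ _ cJ) cJ;
    rewrite qE => -[nd|nd].
  - exact: (nondegenerate_oscillation mX ib p1 q1 eps0 cp iI cJ nd).
  - exact: (nondegenerate_oscillation mX ib q1 p1 eps0 cp' iI cJ nd).
  - exact: (nondegenerate_jump mX ib p1 q1 pq (ltW N0) B0 eps0 K0 cp iI cJ oI
    nd).
  - exact: (nondegenerate_jump mX ib q1 p1 pq (ltW N0) B0 eps0 K0 cp' iI cJ oI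
    nd).
have le : (bmo_norm L (btilde0 L b) <=
    ((D n t eps K ^+ 2 + 2 * (4 * M n eps + D n t eps K) ^+ 2) `^ 2^-1)%:E)%E.
  apply: (bmo_norm_le ib).
  - exact: divr_gt0 N0 eps0.
  - have [[[N1 B1] K1] e1] := (ltW N0, ltW B0, ltW K0, ltW eps0).
    have M1 := divr_ge0 N1 e1.
    rewrite /D /jump_const;
      move: (N n / eps) (N n) (B t) M1 N1 B1 => m n' t' M1 N1 B1.
    have A0 := mulr_ge0 (mulr_ge0 (ler0n R 8) M1) B1.
    have A1 := mulr_ge0 (mulr_ge0 (mulr_ge0 (ler0n R 8) M1) K1) B1.
    have A2 := mulr_ge0 (mulr_ge0 (ler0n R 4) M1) (addr_ge0 K1 (ler0n R 2)).
    have A3 := mulr_ge0 (ler0n R 2) N1.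
    exact: addr_ge0 A2 (divr_ge0 (addr_ge0 (addr_ge0 A3 A1) A0) e1).
  - move=> k m J km LJ pJ.
    exact: (oscillation_osum ib q1 pq (ltW N0) eps0 km LJ (osc _ pJ)).
  - by move=> I J iI pI cJ; apply: jump => //; exact: osc.
split=> //; split; last by apply: (le_lt_trans le); rewrite ltry.
move=> I iI; rewrite /btilde0; case: ifP => _; first exact: DI0.
by apply: Delta_DI => //; exact: ib.
Qed.
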